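(* For $d \geq 2$, every $d$-dimensional normal pseudomanifold is $(d + 1)$-rigid. For $d \geq 3$, the stacked $d$-spheres are exactly the minimally $(d + 1)$-rigid $d$-dimensional normal pseudomanifolds.
   Context: A simplicial complex is a finite set of finite sets closed under taking subsets; an element of size $i+1$ is an $i$-face (the empty set is the unique $(-1)$-face); 1-faces are edges; $V(X)$ is the vertex set; the dimension is the maximal face dimension. A pure $d$-dimensional complex has all maximal faces (facets) of dimension $d$. The link of a face $\alpha$ is $\mathrm{lk}_X(\alpha)=\{\beta\in X:\beta\cap\alpha=\emptyset,\ \alpha\cup\beta\in X\}$. $X$ is connected if its edge graph is connected. A $d$-dimensional normal pseudomanifold ($d\ge1$) is a pure $d$-dimensional simplicial complex in which every $(d-1)$-face lies in exactly two facets and the link of every face of dimension $\le d-2$ (including the empty face, whose link is $X$) is connected. (Gromov) rigidity: for a positive integer $q$, a $d$-dimensional simplicial complex $X$ is $q$-rigid if $X$ is connected and for every set $A\subseteq V(X)$ which is disjoint from at least one $d$-face of $X$, the number of edges of $X$ meeting $A$ is at least $q\cdot\#(A)$. An $n$-vertex $d$-dimensional complex $X$ is minimally $q$-rigid if it is $q$-rigid and has exactly $(n-d-1)q+\binom{d+1}{2}$ edges. The standard $d$-sphere $S^d_{d+2}$ is the complex of all proper subsets of a $(d+2)$-set. Starring a new vertex $v$ in a facet $\sigma$ of a pure $d$-dimensional complex replaces $\sigma$ by the facets $\tau\cup\{v\}$, $\tau$ a $(d-1)$-face of $\sigma$. A stacked $d$-sphere is a complex obtained from $S^d_{d+2}$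 by finitely many such starrings. *)

(* Defs.v *)
From mathcomp Require Import all_boot.
Set Implicit Arguments. Unset Strict Implicit. Unset Printing Implicit Defensive.

Section Complexes.
Variable V : finType.
Implicit Types (X : {set {set V}}) (A B a s : {set V}).

Definition is_complex X : Prop :=
  forall A B, A \in X -> B \subset A -> B \in X.

Definition vertices X : {set V} := \bigcup_(A in X) A.

Definition is_facet X A : bool := (A \in X) && [forall B in X, ~~ (A \proper B)].

Definition has_dim d X : Prop :=
  (exists2 A, A \in X & #|A| = d.+1) /\ (forall A, A \in X -> #|A| <= d.+1).

Definition pure d X : Prop :=
  has_dim d X /\ (forall A, is_facet X A -> #|A| = d.+1).

Definition link X a : {set {set V}} :=
  [set b in X | [disjoint b & a] && ((a :|: b) \in X)].

Definition edge_rel X : rel V := fun u v => [set u; v] \in X.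
Definition connected X : Prop :=
  forall u v, u \in vertices X -> v \in vertices X -> connect (edge_rel X) u v.

Definition normal_pm d X : Prop :=
  [/\ 1 <= d, is_complex X, pure d X,
      (forall A, A \in X -> #|A| = d ->
         #|[set F in X | (#|F| == d.+1) && (A \subset F)]| = 2)
    & (forall a, a \in X -> #|a| <= d.-1 -> connected (link X a))].

Definition edges_meeting X A : {set {set V}} :=
  [set E in X | (#|E| == 2) && ~~ [disjoint E & A]].
Definition edges X : {set {set V}} := [set E in X | #|E| == 2].

(* Gromov q-rigidity for a d-dimensional complex *)
Definition rigid q d X : Prop :=
  connected X /\
  (forall A, A \subset vertices X ->
     (exists2 F, (F \in X) && (#|F| == d.+1) & [disjoint A & F]) ->
     q * #|A| <= #|edges_meeting X A|).

Definition min_rigid q d X : Prop :=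
  rigid q d X /\ #|edges X| = (#|vertices X| - d - 1) * q + 'C(d.+1, 2).

Definition std_sphere (S : {set V}) : {set {set V}} := [set A : {set V} | A \proper S].

Definition starring X s v : {set {set V}} :=
  [set A in X | A != s] :|: [set v |: B | B in [set B : {set V} | B \proper s]].

Inductive stacked (d : nat) : {set {set V}} -> Prop :=
| stacked_base (S : {set V}) : #|S| = d.+2 -> stacked d (std_sphere S)
| stacked_star (X : {set {set V}}) (s : {set V}) (v : V) : stacked d X -> s \in X -> #|s| = d.+1 ->
    v \notin vertices X -> stacked d (starring X s v).

End Complexes.

(* Main.v *)
Require Import Defs.
From mathcomp Require Import all_boot.
From mathcomp Require Import zify.
Set Implicit Arguments. Unset Strict Implicit. Unset Printing Implicit Defensive.

(** Rigidity. Coning raises the rigidity constant by one, so if all vertex links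
    are d-rigid then all vertex stars are (d+1)-rigid; adding overlapping stars one
    at a time gives the (d+1)-rigidity of the whole complex. This reduces everything
    to surfaces, where it is Euler's formula for an open neighbourhood of A, together
    with a collapsing argument bounding the Euler characteristic of a connected A.

    Equality. In a tight (minimally rigid) X, every vertex set W containing a facet
    spans at most (d+1)|W| - C(d+2,2) edges, vertex links are tight, and cliques of
    size at most d are faces. Unless X is a standard sphere, it has a missing facet s.
    The vertices off s are then disconnected: for surfaces by Euler's formula, and in
    general by growing one side of s in the link of a vertex of s star by star, the
    edge count preventing it from ever touching the other side. Cutting along s yields
    two smaller tight complexes, so by induction there is a vertex of degree d+1 off
    any given facet; undoing the starring at that vertex is again a cut. *)

(* [lia] on the arithmetic hypotheses only; cardinals are abstracted first because
   equal ones may carry syntactically different canonical structures. *)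
Ltac natlia := repeat match goal with H : ?P |- _ =>
  lazymatch P with
  | is_true (leq _ _) => fail
  | is_true (~~ (@eq_op _ ?x _)) =>
      let t := type of x in tryif unify t nat then fail else clear H
  | is_true (@eq_op _ ?x _) =>
      let t := type of x in tryif unify t nat then fail else clear H
  | @eq bool (leq _ _) _ => fail
  | @eq ?t _ _ =>
      tryif unify t nat then fail else clear H
  | _ => clear H end end;
  repeat match goal with
  | H : is_true _ |- _ => revert H | H : @eq _ _ _ |- _ => revert H end;
  do ?(let x := fresh "x" in set x := #|_|; clearbody x); lia.

(** * Faces, links, strong connectivity and boundaries of chains *)

Section Pseudomanifolds.
Variable V : finType.
Implicit Types (X T : {set {set V}}) (A B F R S a s : {set V}) (d : nat).

(** The currency throughout is [#|esub X W|], the number of edges spanned by [W]. Rigidity bounds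
    the edges lost when [A] is deleted, and the count is supermodular in [W], so bounds proved on
    stars combine along overlaps. In the equality part the same inequality squeezes: lower bounds on
    two pieces and the tight upper bound on their union leave a lower bound on the intersection. The
    defect ['C(d.+2, 2)] is the amount by which one facet falls short of [d.+1] edges per vertex.
    Topology enters only through chains of facets mod 2: a nonempty proper set of facets has a
    boundary, and boundaries are cycles. This yields the free edges for collapsing, the triangles
    around [A], and the closing up of each side of a cut. The equality part has to start in
    dimension 3: tight surfaces need not be stacked, and the octahedron has no missing facet at all.
    Separation by a missing facet, once there is one, already holds for surfaces, and its induction
    starts there. *)

Definition facets d X : {set {set V}} := [set F in X | #|F| == d.+1].

(** Connectedness as an induction principle: a set of vertices that is closed along link edges and
    holds one link vertex holds them all. No path appears, and closure is checked on faces of [X]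
    itself. *)
Definition link_conn X a : Prop := forall S u v,
  u \notin a -> v \notin a -> u |: a \in X -> v |: a \in X -> u \in S ->
  (forall x y, x \in S -> x \notin a -> y \notin a -> a :|: [set x; y] \in X ->
     y \in S) ->
  v \in S.

Lemma in_facets d X F : (F \in facets d X) = (F \in X) && (#|F| == d.+1).
Proof. by rewrite inE. Qed.

Lemma verticesP X : is_complex X -> forall v, (v \in vertices X) = ([set v] \in X).
Proof.
move=> cX v; apply/bigcupP/idP => [[A AX vA]|vX]; last by exists [set v]; rewrite ?set11.
by apply: (cX A) => //; rewrite sub1set.
Qed.

Lemma in_link X a b : is_complex X ->
  (b \in link X a) = [disjoint b & a] && (a :|: b \in X).
Proof.
move=> cX; rewrite inE; case: (boolP (a :|: b \in X)) => abX; rewrite ?andbF //.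
by rewrite (cX _ _ abX) // subsetUr.
Qed.

Lemma complex_link X a : is_complex X -> is_complex (link X a).
Proof.
move=> cX A B; rewrite !in_link // => /andP[dA aA] BA.
rewrite (disjointWl BA dA) /=; apply: (cX _ _ aA).
by rewrite setUS.
Qed.

Lemma link_connP X a : is_complex X -> connected (link X a) <-> link_conn X a.
Proof.
move=> cX; have cL := complex_link (a := a) cX.
have vL w : (w \in vertices (link X a)) = (w \notin a) && (w |: a \in X).
  by rewrite verticesP // in_link // disjoints1 setUC.
split=> [cn S u v ua va uX vX uS cl|lc u v].
  have /connectP[p pp ->]: connect (edge_rel (link X a)) u v.
    by apply: cn; rewrite vL ?ua ?va.
  elim: p u uS {uX ua cn} pp => //= w p IH u uS /andP[uw pp].
  apply: IH pp; move: uw; rewrite /edge_rel in_link // => /andP[dd uwX].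
  have [u1 w1] : u \notin a /\ w \notin a.
    by split; rewrite (disjointFr dd) // !inE eqxx ?orbT.
  exact: (cl u w).
rewrite !vL => /andP[ua uX] /andP[va vX].
have: v \in [set y | connect (edge_rel (link X a)) u y].
  apply: (lc _ u) => //; rewrite ?inE ?connect0 // => x y.
  rewrite !inE => ux xa ya xyX; apply: connect_trans ux _; apply: connect1.
  rewrite /edge_rel in_link // xyX andbT disjoint_sym disjoints_subset.
  apply/subsetP=> z za; rewrite !inE negb_or; apply/andP; split.
    by apply: contraNneq xa => <-.
  by apply: contraNneq ya => <-.
by rewrite inE.
Qed.

Lemma npm_gt0 d X : normal_pm d X -> 0 < d. Proof. by case. Qed.
Lemma npm_complex d X : normal_pm d X -> is_complex X. Proof. by case. Qed.
Lemma npm_dim d X : normal_pm d X -> forall A, A \in X -> #|A| <= d.+1.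
Proof. by case=> _ _ [[_ ?] _]. Qed.
Lemma npm_ridge d X : normal_pm d X -> forall R, R \in X -> #|R| = d ->
  #|[set F in facets d X | R \subset F]| = 2.
Proof.
case=> _ _ _ h _ R RX /(h R RX) <-; apply: eq_card => F.
by rewrite !inE andbA.
Qed.
Lemma npm_conn d X : normal_pm d X ->
  forall a, a \in X -> #|a| <= d.-1 -> link_conn X a.
Proof. by case=> _ cX _ _ h a aX da; apply/link_connP/h. Qed.

Lemma npm_ext d X : normal_pm d X -> forall A, A \in X ->
  exists2 F, F \in facets d X & A \subset F.
Proof.
case=> _ cX [_ fX] _ _ A AX.
have PA : (A \in X) && (A \subset A) by rewrite AX /=.
case: (@arg_maxnP _ A (fun F => (F \in X) && (A \subset F)) (fun F => #|F|) PA).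
move=> F /andP[FX AF] mF; exists F => //; rewrite in_facets FX; apply/eqP.
apply: fX; rewrite /is_facet FX; apply/forall_inP => B BX.
apply/negP => FB; have := proper_card FB; rewrite ltnNge => /negP[].
by apply: mF; rewrite BX (subset_trans AF (proper_sub FB)).
Qed.

Lemma npm_facet d X : normal_pm d X -> exists F, F \in facets d X.
Proof. by case=> _ _ [[[F FX /eqP dF] _] _]; exists F; rewrite in_facets FX. Qed.

Lemma npm_set0 d X : normal_pm d X -> set0 \in X.
Proof.
move=> nX; have [F] := npm_facet nX; rewrite in_facets => /andP[FX _].
by apply: (npm_complex nX) FX _; rewrite sub0set.
Qed.

(** Purity enters as extendability of every face to a facet, the form in which links, caps and
    starrings provide it. *)
Lemma npmI d X : 0 < d -> is_complex X -> set0 \in X ->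
  (forall A, A \in X -> exists2 F, F \in facets d X & A \subset F) ->
  (forall R, R \in X -> #|R| = d -> #|[set F in facets d X | R \subset F]| = 2) ->
  (forall a, a \in X -> #|a| <= d.-1 -> link_conn X a) -> normal_pm d X.
Proof.
move=> d0 cX X0 ext rid lc; split=> //.
- have dim A : A \in X -> #|A| <= d.+1.
    by case/ext=> F; rewrite in_facets => /andP[_ /eqP <-] /subset_leq_card.
  split; last first.
    move=> A /andP[AX /forall_inP mA]; have [F] := ext A AX.
    rewrite in_facets => /andP[FX /eqP <-] AF; apply/eqP.
    move/mA: FX; rewrite properE AF /= negbK => FA.
    by rewrite eqn_leq !subset_leq_card.
  split=> //; have [F] := ext _ X0; rewrite in_facets => /andP[FX /eqP dF] _.
  by exists F.
- move=> R RX dR; rewrite -(rid R RX dR); apply: eq_card => F.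
  by rewrite !inE andbA.
by move=> a aX da; apply/link_connP/lc.
Qed.

(* Strong connectivity, proved face by face: all facets above [a] agree, by
   descending induction on [#|a|]. *)
Lemma npm_strong d X T : normal_pm d X ->
  (forall R F F', R \in X -> #|R| = d -> F \in facets d X -> F' \in facets d X ->
     R \subset F -> R \subset F' -> F \in T -> F' \in T) ->
  forall F F', F \in facets d X -> F' \in facets d X -> F \in T -> F' \in T.
Proof.
move=> nX cl; have cX := npm_complex nX; have d0 := npm_gt0 nX.
suff H k a F F' : a \in X -> d - #|a| <= k -> #|a| <= d -> F \in facets d X ->
    F' \in facets d X -> a \subset F -> a \subset F' -> F \in T -> F' \in T.
  move=> F F' FX FX'; apply: (H d set0) => //; rewrite ?sub0set ?cards0 ?leq_subr //.
  exact: npm_set0 nX.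
elim: k a F F' => [|k IH] a F F' aX dk da FX FX' aF aF' FT;
  have [dE|dN] := eqVneq #|a| d; try exact: (cl a F); first by natlia.
have {dN} da' : #|a| < d by natlia.
have [u uF ua] : exists2 u, u \in F & u \notin a.
  apply/subsetPn; apply/negP => /subset_leq_card; move: FX.
  rewrite in_facets => /andP[_ /eqP ->]; natlia.
have [v vF va] : exists2 v, v \in F' & v \notin a.
  apply/subsetPn; apply/negP => /subset_leq_card; move: FX'.
  rewrite in_facets => /andP[_ /eqP ->]; natlia.
(* The vertices through which some facet above [a] in [T] passes. By induction ([agree]) all facets
   above [x |: a] then lie in [T], so this set is closed along link edges. *)
pose S := [set x | [exists G in facets d X, (x |: a \subset G) && (G \in T)]].
have agree x G G' : x \notin a -> G \in facets d X -> G' \in facets d X ->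
    x |: a \subset G -> x |: a \subset G' -> G \in T -> G' \in T.
  move=> xa GX G'X xG xG'; have cxa : #|x |: a| = #|a|.+1 by rewrite cardsU1 xa.
  apply: (IH _ _ _ _ _ _ GX G'X xG xG'); rewrite ?cxa //; last by natlia.
  by move: GX; rewrite in_facets => /andP[GX _]; apply: cX GX _.
have : v \in S.
  apply: (npm_conn nX aX _ ua va) => //; first natlia.
  - move: FX; rewrite in_facets => /andP[FX _]; apply: cX FX _.
    by rewrite subUset sub1set uF.
  - move: FX'; rewrite in_facets => /andP[FX' _]; apply: cX FX' _.
    by rewrite subUset sub1set vF.
  - by rewrite inE; apply/exists_inP; exists F => //; rewrite FT subUset sub1set uF aF.
  move=> x y; rewrite !inE => /exists_inP[G GX /andP[xG GT]] xa ya xyX.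
  have [G' G'X sG'] := npm_ext nX xyX; apply/exists_inP; exists G' => //.
  apply/andP; split.
    by apply: subset_trans sG'; rewrite setUC setUS // sub1set !inE eqxx orbT.
  apply: (agree x G) => //.
  by apply: subset_trans sG'; rewrite setUC setUS // sub1set !inE eqxx.
rewrite inE => /exists_inP[G GX /andP[vG GT]]; apply: (agree v G) => //.
by rewrite subUset sub1set vF.
Qed.

(** For a set [T] of facets a ridge lies in at most two members, so exactly one means an odd number:
    this is the mod 2 boundary of the chain [T]. *)
Definition bd d X T : {set {set V}} :=
  [set R in X | (#|R| == d) && (#|[set F in T | R \subset F]| == 1)].

(** Without a boundary ridge, one facet of [T] at a ridge forces the other into [T], and strong
    connectivity puts every facet there. *)
Lemma bd_neq0 d X T F F' : normal_pm d X -> T \subset facets d X ->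
  F \in T -> F' \in facets d X -> F' \notin T -> exists R, R \in bd d X T.
Proof.
move=> nX sT FT FX' FT'.
apply/set0Pn; apply: contraNneq FT' => b0.
have FX := subsetP sT F FT.
apply: (npm_strong nX _ FX) => // {FX FX'}R {}G {}F' RX dR GX GX' RG RG' GT.
have := negbT (in_set0 R); rewrite -b0 inE RX dR eqxx /= => c1.
have sub : [set F in T | R \subset F] \subset [set F in facets d X | R \subset F].
  by apply/subsetP=> H; rewrite !inE => /andP[/(subsetP sT)]; rewrite in_facets => -> ->.
have c2 := npm_ridge nX RX dR.
have c0 : 0 < #|[set F in T | R \subset F]|.
  by apply/card_gt0P; exists G; rewrite inE GT.
have /eqP eq : [set F in T | R \subset F] == [set F in facets d X | R \subset F].
  by rewrite eqEcard sub c2 ltn_neqAle eq_sym c1.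
have : F' \in [set F in facets d X | R \subset F] by rewrite inE GX'.
by rewrite -eq inE => /andP[].
Qed.

Lemma double_count (I J : finType) (P : {set I}) (Q : {set J}) (r : I -> J -> bool) :
  \sum_(x in P) #|[set y in Q | r x y]| = \sum_(y in Q) #|[set x in P | r x y]|.
Proof.
transitivity (\sum_(x in P) \sum_(y in Q) (r x y : nat)).
  by apply: eq_bigr => x _; rewrite -sum1dep_card big_mkcondr.
rewrite exchange_big /=; apply: eq_bigr => y _.
by rewrite -sum1dep_card big_mkcondr.
Qed.

(** Always used with [#|F| - #|a| = 2]: exactly two sets lie strictly between. *)
Lemma card_between a F : a \subset F ->
  #|[set R : {set V} | [&& a \subset R, R \subset F & #|R| == #|a|.+1]]| = #|F| - #|a|.
Proof.
move=> aF; rewrite -(cardsDS aF).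
rewrite -(card_in_imset (f := fun x => x |: a) (D := F :\: a)); last first.
  move=> x y; rewrite !inE => /andP[xa _] /andP[ya _] /setP/(_ x).
  by rewrite !inE eqxx (negPf xa) !orbF => /esym/eqP.
apply: eq_card => R; rewrite inE; apply/and3P/imsetP.
  case=> aR RF /eqP cR.
  have /cards1P[x Rx] : #|R :\: a| == 1 by rewrite cardsDS // cR subSnn.
  have : x \in R :\: a by rewrite Rx set11.
  rewrite inE => /andP[xa xR]; exists x; first by rewrite inE xa (subsetP RF).
  by rewrite -Rx setUC -{1}(setIidPr aR) setID.
case=> x; rewrite inE => /andP[xa xF] ->.
by rewrite subsetUr subUset sub1set xF aF cardsU1 xa.
Qed.

(* The mod 2 boundary of a chain of facets is a cycle. *)
Lemma bd_even d X T a : normal_pm d X -> T \subset facets d X -> #|a| = d.-1 ->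
  ~~ odd #|[set R in bd d X T | a \subset R]|.
Proof.
move=> nX sT da; have d0 := npm_gt0 nX; have cX := npm_complex nX.
pose P := [set R in X | (#|R| == d) && (a \subset R)].
pose n R := #|[set F in T | R \subset F]|.
(* Each facet above [a] has exactly two ridges above [a], so the incidences of [T] with these ridges
   are even in number. Ridges in zero or two facets of [T] do not affect the parity. *)
have E : \sum_(R in P) n R = \sum_(F in [set F in T | a \subset F]) 2.
  rewrite /n double_count (bigID (fun F => a \subset F)) /=.
  rewrite [X in _ + X]big1 ?addn0; last first.
    move=> F /andP[_ aF]; apply/eqP; rewrite cards_eq0; apply/eqP/setP => R.
    rewrite !inE; apply/negP => /andP[/and3P[_ _ aR] RF].
    by rewrite (subset_trans aR RF) in aF.
  rewrite (eq_bigl (fun F => F \in [set F in T | a \subset F])); last by move=> F; rewrite !inE.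
  apply: eq_bigr => F; rewrite inE => /andP[/(subsetP sT)]; rewrite in_facets.
  case/andP=> FX /eqP dF aF; have := card_between aF; rewrite dF da.
  have -> : d.+1 - d.-1 = 2 by natlia.
  move=> <-; apply: eq_card => R; rewrite !inE prednK //.
  case: (boolP (R \subset F)) => RF; rewrite ?andbF //= ?andbT.
  by rewrite (cX _ _ FX RF) /= andbC.
have : ~~ odd (\sum_(R in P) n R) by rewrite E sum_nat_const oddM andbF.
rewrite (bigID (fun R => n R == 1)) /= oddD.
have -> : odd (\sum_(R in P | n R != 1) n R) = false.
  apply: (big_ind (fun k => odd k = false)) => // [x y xo yo|R]; first by rewrite oddD xo yo.
  rewrite !inE => /andP[/and3P[RX /eqP dR aR] n1].
  have : n R <= 2.
    rewrite -(npm_ridge nX RX dR); apply: subset_leq_card; apply/subsetP=> F.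
    by rewrite !inE => /andP[/(subsetP sT)]; rewrite in_facets => -> ->.
  by case: (n R) n1 => [|[|[|]]].
rewrite addbF (eq_bigr (fun=> 1)) => [|R /andP[_ /eqP]//].
rewrite sum1dep_card; congr (~~ odd _); apply: eq_card => R.
by rewrite !inE -!andbA; do !bool_congr.
Qed.

Lemma bd_other d X T R a : normal_pm d X -> T \subset facets d X ->
  R \in bd d X T -> a \subset R -> #|a| = d.-1 ->
  exists R', [/\ R' \in bd d X T, a \subset R' & R' != R].
Proof.
move=> nX sT RT aR da; have := bd_even nX sT da.
rewrite (cardsD1 R) inE RT aR /= negbK => o.
have : 0 < #|[set R in bd d X T | a \subset R] :\ R| by case: (#|_|) o.
by case/card_gt0P=> R'; rewrite !inE => /and3P[nR bR aR']; exists R'; rewrite inE.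
Qed.

End Pseudomanifolds.

(** * Vertex links and stars *)

Section Links.
Variable V : finType.
Implicit Types (X T : {set {set V}}) (A B F R S a s U W : {set V}) (d : nat).

(** The closed neighbourhood: [[set w; w]] is [[set w]], so a vertex [w] belongs to it. It is the
    vertex set of the star of [w]. *)
Definition nb X w : {set V} := [set v | [set v; w] \in X].
Definition esub X W : {set {set V}} := [set E in X | (#|E| == 2) && (E \subset W)].

Lemma in_vlink X w b : is_complex X ->
  (b \in link X [set w]) = (w \notin b) && (w |: b \in X).
Proof. by move=> cX; rewrite in_link // disjoint_sym disjoints1. Qed.

Lemma npm_connected d X : normal_pm d X -> connected X.
Proof.
move=> nX; have [_ cX _ _ h] := nX.
have := h set0 (npm_set0 nX); rewrite cards0 => /(_ isT).
suff -> : link X set0 = X by [].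
by apply/setP=> A; rewrite in_link // set0U disjoint_sym disjoints_subset sub0set.
Qed.

Lemma in_nb X w v : (v \in nb X w) = ([set v; w] \in X).
Proof. by rewrite inE. Qed.

Lemma nb_self X w : [set w] \in X -> w \in nb X w.
Proof. by rewrite inE setUid. Qed.

Lemma face_vertices X F : F \in X -> F \subset vertices X.
Proof. by move=> FX; apply/subsetP=> v vF; apply/bigcupP; exists F. Qed.

Lemma nb_vertices X w : nb X w \subset vertices X.
Proof.
apply/subsetP=> v; rewrite inE => /face_vertices/subsetP; apply.
by rewrite !inE eqxx.
Qed.

Lemma face_nb X F w : is_complex X -> F \in X -> w \in F -> F \subset nb X w.
Proof.
move=> cX FX wF; apply/subsetP=> v vF; rewrite inE; apply: (cX _ _ FX).
by rewrite subUset !sub1set vF.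
Qed.

Lemma vertices_vlink X w : is_complex X -> vertices (link X [set w]) = nb X w :\ w.
Proof.
move=> cX; apply/setP=> v; rewrite verticesP; last exact: complex_link.
by rewrite in_vlink // !inE setUC eq_sym.
Qed.

Lemma facets_vlink d X w F : is_complex X -> F \in facets d.+1 X -> w \in F ->
  F :\ w \in facets d (link X [set w]).
Proof.
move=> cX; rewrite !in_facets => /andP[FX /eqP dF] wF.
by rewrite in_vlink // setD1K // FX !inE eqxx /=; rewrite (cardsD1 w) wF in dF; natlia.
Qed.

Lemma npm_vlink d X w : 0 < d -> normal_pm d.+1 X -> [set w] \in X ->
  normal_pm d (link X [set w]).
Proof.
move=> d0 nX wX; have cX := npm_complex nX.
apply: npmI => //; first exact: complex_link.
- by rewrite in_vlink // inE /= setU0.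
- move=> A; rewrite in_vlink // => /andP[wA wAX].
  have [F FX sF] := npm_ext nX wAX; exists (F :\ w).
    by apply: facets_vlink => //; apply: (subsetP sF); rewrite setU11.
  by rewrite subsetD1 wA andbT (subset_trans _ sF) // subsetUr.
- move=> R; rewrite in_vlink // => /andP[wR wRX] dR.
  rewrite -(npm_ridge nX wRX); last by rewrite cardsU1 wR dR.
  rewrite -(card_in_imset (f := fun F => w |: F)); last first.
    move=> F G; rewrite inE in_facets in_vlink // => /andP[/andP[/andP[wF _] _] _].
    rewrite inE in_facets in_vlink // => /andP[/andP[/andP[wG _] _] _].
    by move=> /(congr1 (fun H => H :\ w)); rewrite !setU1K.
  apply: eq_card => F; rewrite inE; apply/imsetP/andP.
    case=> G; rewrite inE !in_facets in_vlink // => /andP[/andP[/andP[wG GX] /eqP dG] RG] ->.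
    by rewrite GX cardsU1 wG dG add1n eqxx setUS.
  case=> FX sF; have wF : w \in F by apply: (subsetP sF); rewrite setU11.
  exists (F :\ w); last by rewrite setD1K.
  by rewrite inE facets_vlink // subsetD1 wR andbT (subset_trans _ sF) // subsetUr.
move=> a; rewrite in_vlink // => /andP[wa waX] da S u v ua va uX vX uS cl.
move: uX vX; rewrite !in_vlink // !inE !negb_or => /andP[/andP[uw _] uX] /andP[/andP[vw _] vX].
rewrite setUCA in uX; rewrite setUCA in vX.
apply: (npm_conn nX waX _ _ _ uX vX uS); rewrite ?cardsU1 ?wa ?inE ?negb_or ?(eq_sym u) ?(eq_sym v) ?uw ?vw //; first by natlia.
move=> x y xS; rewrite !inE !negb_or => /andP[xw xa] /andP[yw ya] xyX.
apply: (cl x y) => //; rewrite in_vlink // !inE !negb_or wa eq_sym xw eq_sym yw /=.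
by rewrite setUA.
Qed.

Lemma card_disjoint_sub (T : finType) (A B D : {set T}) :
  [disjoint A & B] -> A \subset D -> B \subset D -> #|A| + #|B| <= #|D|.
Proof.
move=> dAB AD BD; have := leq_card_setU A B; rewrite dAB => /leqifP/eqP <-.
by apply: subset_leq_card; rewrite subUset AD.
Qed.

Lemma card_spokes w B : w \notin B -> #|[set [set w; x] | x in B]| = #|B|.
Proof.
move=> wB; apply: card_in_imset => x y xB yB /setP/(_ x); rewrite !inE eqxx orbT.
by move=> /esym/orP[/eqP xw|/eqP//]; rewrite -xw xB in wB.
Qed.

Lemma esubT X : esub X setT = edges X.
Proof. by apply/setP=> E; rewrite !inE subsetT andbT. Qed.

Lemma esub_sub X U W : U \subset W -> esub X U \subset esub X W.
Proof.
move=> UW; apply/subsetP=> E; rewrite !inE => /and3P[-> -> EU].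
exact: subset_trans UW.
Qed.

Lemma esubI X U W : esub X (U :&: W) = esub X U :&: esub X W.
Proof.
apply/setP=> E; rewrite !inE subsetI; case: (E \in X); case: (#|E| == 2) => //=.
Qed.

(** Supermodularity: edges between [U :\: W] and [W :\: U] are seen only by the union. *)
Lemma esub_super X U W : #|esub X U| + #|esub X W| <=
  #|esub X (U :|: W)| + #|esub X (U :&: W)|.
Proof.
rewrite -cardsUI esubI leq_add2r; apply: subset_leq_card.
by rewrite subUset !esub_sub ?subsetUl ?subsetUr.
Qed.

(** Turns rigidity into a statement about spanned edges, where supermodularity applies. *)
Lemma card_edges_meeting X A : #|edges_meeting X A| + #|esub X (~: A)| = #|edges X|.
Proof.
rewrite -(cardsID (edges_meeting X A) (edges X)); congr (_ + _); apply: eq_card => E;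
  rewrite !inE; case: (E \in X); rewrite //= ?andbF //; case: (#|E| == 2) => //=.
by rewrite disjoints_subset andbT negbK.
Qed.

(* The cone over a [q]-rigid link is [(q+1)]-rigid. *)
Lemma star_step d X w B F : is_complex X ->
  rigid d.+1 d (link X [set w]) -> F \in facets d.+1 X -> w \in F -> [disjoint B & F] ->
  d.+2 * #|B :&: nb X w| + #|esub X (nb X w :\: B)| <= #|esub X (nb X w)|.
Proof.
move=> cX [_ rL] FX wF dBF; set L := link X [set w] in rL *; set N := nb X w.
have wB : w \notin B by rewrite (disjointFl dBF).
have cL : is_complex L by apply: complex_link.
have vL : vertices L = N :\ w by apply: vertices_vlink.
pose B' := B :&: N.
have sB' : B' \subset vertices L.
  by rewrite vL subsetD1 subsetIr /= inE (negPf wB).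
have rB : d.+1 * #|B'| <= #|edges_meeting L B'|.
  apply: rL => //; exists (F :\ w); first by have := facets_vlink cX FX wF; rewrite in_facets.
  by apply: disjointW (subsetIl _ _) (subsetDl _ _) dBF.
(* The cone edges from [w] to [B'], one for each vertex: they raise the constant from [d.+1] to
   [d.+2]. *)
pose Sp := [set [set w; x] | x in B'].
have cSp : #|Sp| = #|B'| by apply: card_spokes; rewrite inE (negPf wB).
have EN E : E \in edges_meeting L B' -> [/\ w \notin E, E \in X, #|E| = 2, ~~ [disjoint E & B'] & E \subset N].
  rewrite inE => /andP[EL /andP[/eqP cE mE]]; split=> //.
  - by move: EL; rewrite in_vlink // => /andP[].
  - by move: EL; rewrite in_vlink // => /andP[_ EX]; apply: cX EX _; apply: subsetUr.
  - by apply: subset_trans (face_vertices EL) _; rewrite vL subsetDl.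
have d1 : [disjoint edges_meeting L B' & Sp].
  rewrite disjoints_subset; apply/subsetP=> E /EN[wE _ _ _ _]; rewrite inE.
  by apply/imsetP=> -[x _ eE]; rewrite eE !inE eqxx in wE.
have wX : w \in N.
  by apply: nb_self; move: FX; rewrite in_facets => /andP[FX _]; apply: cX FX _; rewrite sub1set.
have d2 : [disjoint edges_meeting L B' :|: Sp & esub X (N :\: B)].
  rewrite disjoints_subset; apply/subsetP=> E; rewrite in_setU in_setC => ESp.
  apply/negP; rewrite inE => /and3P[EX cE sE]; case/orP: ESp.
    move=> /EN[_ _ _ /negP mE _]; apply: mE.
    rewrite disjoints_subset; apply: subset_trans sE _.
    by apply/subsetP=> z; rewrite !inE => /andP[/negPf ->].
  case/imsetP=> x; rewrite inE => /andP[xB xN] eE.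
  by move/subsetP/(_ x): sE; rewrite eE !inE eqxx orbT xB => /(_ isT).
have := card_disjoint_sub d2 (_ : _ \subset esub X N) (esub_sub X (subsetDl _ _)).
have c12 : #|edges_meeting L B' :|: Sp| = #|edges_meeting L B'| + #|B'|.
  by rewrite -cSp; apply/eqP; have := leq_card_setU (edges_meeting L B') Sp; rewrite d1 => /leqifP.
rewrite c12 => h; apply: leq_trans (h _).
  by rewrite -/B' mulSn; natlia.
apply/subsetP=> E; rewrite in_setU => /orP[/EN[_ EX cE _ EN']|].
  by rewrite inE EX cE.
case/imsetP=> x; rewrite inE => /andP[xB xN] ->; rewrite inE.
have xw : w != x by apply: contraNneq wB => ->.
by rewrite cards2 xw eqxx subUset !sub1set wX xN setUC; move: xN; rewrite inE => ->.
Qed.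

(* The region [U] is enlarged star by star until it is everything. *)
Lemma rigid_step d X : 0 < d -> normal_pm d.+1 X ->
  (forall w, [set w] \in X -> rigid d.+1 d (link X [set w])) -> rigid d.+2 d.+1 X.
Proof.
move=> d0 nX rL; have cX := npm_complex nX.
have lc0 := npm_conn nX (npm_set0 nX); rewrite cards0 leq0n in lc0; have {}lc0 := lc0 isT.
split; first exact: npm_connected nX.
move=> A sA [F /andP[FX /eqP cF] dAF].
have FF : F \in facets d.+1 X by rewrite in_facets FX cF /=.
have Fn0 : 0 < #|F| by rewrite cF.
suff [U [US bU]] : exists U, vertices X \subset U /\
    d.+2 * #|A :&: U| + #|esub X (U :\: A)| <= #|esub X U|.
  have := card_edges_meeting X A.
  have -> : esub X (~: A) = esub X (U :\: A).
    apply/setP=> E; rewrite !inE; case: (boolP (E \in X)) => //= EX; congr (_ && _).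
    by rewrite subsetD (subset_trans (face_vertices EX) US) -disjoints_subset.
  move: bU; rewrite (setIidPl (subset_trans sA US)).
  have -> : esub X U = edges X.
    apply/setP=> E; rewrite !inE; case: (boolP (E \in X)) => //= EX.
    by rewrite (subset_trans (face_vertices EX) US) andbT.
  natlia.
(* The middle clause lets the star of any [w] in [U] be added: a facet at [w] inside [U] avoids
   [A :\: U], as [star_step] requires. *)
pose P U := [&& F \subset U, [forall u in U, [exists G in facets d.+1 X, (u \in G) && (G \subset U)]]
   & d.+2 * #|A :&: U| + #|esub X (U :\: A)| <= #|esub X U|].
have PF : P F.
  rewrite /P subxx /=; apply/andP; split.
    by apply/forall_inP=> u uF; apply/exists_inP; exists F; rewrite ?uF ?subxx.
  have -> : F :\: A = F by apply/setDidPl; rewrite disjoint_sym.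
  by move: dAF; rewrite -setI_eq0 => /eqP ->; rewrite cards0 muln0.
case: (@arg_maxnP _ F P (fun U => #|U|) PF) => U /and3P[FU /forall_inP sU bU] mU.
have step w : w \in U -> nb X w \subset U.
  move=> wU; have /exists_inP[G GX /andP[wG GU]] := sU w wU.
  set N := nb X w.
  suff /mU cU : P (U :|: N).
    apply/setUidPl/esym/eqP; rewrite eqEcard subsetUl; exact: cU.
  have wX : [set w] \in X.
    by move: GX; rewrite in_facets => /andP[GX _]; apply: cX GX _; rewrite sub1set.
  rewrite /P (subset_trans FU (subsetUl _ _)) /=; apply/andP; split.
    apply/forall_inP=> u; rewrite inE => /orP[/sU/exists_inP[H HX /andP[uH HU]]|].
      by apply/exists_inP; exists H => //; rewrite uH (subset_trans HU) ?subsetUl.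
    rewrite in_nb => /(npm_ext nX)[H HX]; rewrite subUset !sub1set => /andP[uH wH].
    apply/exists_inP; exists H => //; rewrite uH subsetU // face_nb ?orbT //.
    by move: HX; rewrite in_facets => /andP[].
  have dG : [disjoint A :\: U & G].
    rewrite disjoint_sym disjoints_subset; apply/subsetP=> x /(subsetP GU).
    by rewrite !inE => ->.
  have h1 := star_step cX (rL w wX) GX wG dG.
  rewrite -/N in h1; clearbody N.
  (* [A] is deleted from [U :|: N] in two stages. Deleting [A :\: U] loses at least as many edges as
     it does inside the star [N]; deleting the rest loses at least as many as it does inside [U]. *)
  have h2 := esub_super X ((U :|: N) :\: (A :\: U)) N.
  have h3 := esub_super X ((U :|: N) :\: A) U.
  have e1 : (U :|: N) :\: (A :\: U) :|: N = U :|: N.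
    by apply/setP=> x; rewrite !inE; case: (x \in U); case: (x \in N); case: (x \in A).
  have e2 : ((U :|: N) :\: (A :\: U)) :&: N = N :\: (A :\: U).
    by apply/setP=> x; rewrite !inE; case: (x \in U); case: (x \in N); case: (x \in A).
  have e3 : (U :|: N) :\: A :|: U = (U :|: N) :\: (A :\: U).
    by apply/setP=> x; rewrite !inE; case: (x \in U); case: (x \in N); case: (x \in A).
  have e4 : ((U :|: N) :\: A) :&: U = U :\: A.
    by apply/setP=> x; rewrite !inE; case: (x \in U); case: (x \in N); case: (x \in A).
  rewrite e1 e2 in h2; rewrite e3 e4 in h3.
  have -> : #|A :&: (U :|: N)| = #|A :&: U| + #|(A :\: U) :&: N|.
    rewrite -(cardsID U (A :&: (U :|: N))); congr (_ + _); apply: eq_card => x; rewrite !inE;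
      by case: (x \in U); case: (x \in N); case: (x \in A).
  rewrite mulnDr; natlia.
exists U; split=> //; apply/subsetP=> v; rewrite verticesP // => vX.
have /card_gt0P[u uF] := Fn0.
apply: (lc0 _ u v); rewrite ?inE ?setU0 //.
- by apply: cX FX _; rewrite sub1set.
- exact: (subsetP FU).
move=> x y xU _ _; rewrite set0U setUC => yx; apply: (subsetP (step x xU)).
by rewrite inE.
Qed.

End Links.

(** * Surfaces *)

Section Surfaces.
Variable V : finType.
Implicit Types (X T E : {set {set V}}) (A B F R S a e s U W : {set V}) (d : nat).

Lemma surface_edges X W : normal_pm 2 X ->
  2 * #|esub X W| = \sum_(F in facets 2 X) 'C(#|F :&: W|, 2).
Proof.
move=> nX; have cX := npm_complex nX.
transitivity (\sum_(e in esub X W) #|[set F in facets 2 X | e \subset F]|).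
  rewrite mulnC -sum_nat_const; apply: eq_bigr => e; rewrite inE => /and3P[eX /eqP ce _].
  by rewrite (npm_ridge nX eX ce).
rewrite double_count; apply: eq_bigr => F; rewrite in_facets => /andP[FX _].
rewrite -cards_draws; apply: eq_card => e; rewrite !inE subsetI.
case: (boolP (e \subset F)) => eF; rewrite ?andbF //= andbT.
by rewrite (cX _ _ FX eF) /= andbC.
Qed.

Definition tri X A k : {set {set V}} := [set F in facets 2 X | #|F :&: A| == k].

(* Euler's formula, relative to the open neighbourhood of [A]. *)
Lemma surface_euler X A : normal_pm 2 X ->
  #|edges X| + 3 * #|tri X A 3| = #|esub X (~: A)| + 3 * #|esub X A| + #|tri X A 1|.
Proof.
move=> nX.
have t k : #|tri X A k| = \sum_(F in facets 2 X) (#|F :&: A| == k : nat).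
  by rewrite -sum1dep_card big_mkcondr.
(* Doubled, every term is a sum over triangles, and the identity holds for each triangle [F]
   separately, by the value of [#|F :&: A|]. *)
suff : 2 * #|edges X| + 6 * #|tri X A 3| =
       2 * #|esub X (~: A)| + 3 * (2 * #|esub X A|) + 2 * #|tri X A 1| by natlia.
rewrite -esubT !surface_edges // !t !big_distrr /= -!big_split /=.
apply: eq_bigr => F; rewrite in_facets => /andP[_ /eqP cF].
have := cardsID A F; rewrite setIT cF -setDE.
by case: #|F :&: A| => [|[|[|[|k]]]]; case: #|F :\: A| => [|[|[|[|l]]]].
Qed.

(** Connectedness of the graph [E] on [A], phrased by cuts. [E] need not come from a complex, so
    edges can be deleted one by one in a collapse. *)
Definition linked E A := forall S x y, x \in A -> x \in S -> y \in A -> y \notin S ->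
  exists u v, [/\ u \in A :&: S, v \in A :\: S & [set u; v] \in E].

(** A largest [S] containing [r] and spanning at least [#|S| - 1] edges is all of [A]: otherwise an
    edge crosses out of [S], and its other end can be added. *)
Lemma tree_bound E A : linked E A -> #|A| <= #|E|.+1.
Proof.
move=> lA; have [->|/set0Pn[r rA]] := eqVneq A set0; first by rewrite cards0.
pose P S := [&& S \subset A, r \in S & #|S| <= #|[set e in E | e \subset S]|.+1].
have Pr : P [set r] by rewrite /P sub1set rA set11 cards1.
case: (@arg_maxnP _ [set r] P (fun S => #|S|) Pr) => S /and3P[SA rS cS] mS.
suff -> : A = S.
  apply: leq_trans cS _; rewrite ltnS subset_leq_card //.
  by apply/subsetP=> e; rewrite inE => /andP[].
apply/eqP; rewrite eqEsubset SA andbT; apply/subsetP => y yA; apply: contraT => yS.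
have [u [v [/setIP[uA uS] /setDP[vA vS] uv]]] := lA S r y rA rS yA yS.
have /mS : P (v |: S); last by rewrite /geq /= cardsU1 vS add1n ltnn.
rewrite /P subUset sub1set vA SA !inE rS orbT cardsU1 vS /= add1n ltnS.
apply: leq_trans cS _; apply: proper_card; rewrite properE; apply/andP; split.
  apply/subsetP=> e; rewrite !inE => /andP[-> eS].
  by rewrite (subset_trans eS) ?subsetUr.
apply/subsetPn; exists [set u; v].
  by rewrite inE uv subUset !sub1set !inE uS eqxx orbT.
by rewrite inE uv /= subUset !sub1set (negPf vS) andbF.
Qed.

(* Each collapse of a triangle along a free edge keeps the graph connected. *)
Lemma collapse_bound E T A : linked E A ->
  (forall F e, F \in T -> e \subset F -> #|e| = 2 -> e \in E) ->
  (forall F, F \in T -> #|F| = 3 /\ F \subset A) ->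
  (forall T', T' \subset T -> T' != set0 ->
     exists R F, [/\ #|R| = 2, F \in T', R \subset F &
       forall F', F' \in T' -> R \subset F' -> F' = F]) ->
  #|A| + #|T| <= #|E|.+1.
Proof.
elim: {T}_.+1 {-2}T (ltnSn #|T|) E => // n IH T; rewrite ltnS => Tn E lA cl cT free.
have [T0|Tn0] := eqVneq T set0; first by rewrite T0 cards0 addn0 tree_bound.
have [R [F [cR FT RF uF]]] := free T (subxx _) Tn0.
have RE : R \in E by apply: cl RF cR.
have [cF FA] := cT F FT.
have := cardsD1 F T; have := cardsD1 R E; rewrite FT RE => eE eT.
have := IH (T :\ F) _ (E :\ R); rewrite eE eT !add1n addnS ltnS; apply.
- by move: Tn; rewrite eT.
- move=> S x y xA xS yA yS; have [u [v [uS vS uvE]]] := lA S x y xA xS yA yS.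
  have [uvR|uvR] := eqVneq [set u; v] R; last by exists u, v; split; rewrite // in_setD1 uvR.
  (* If the crossing edge is the deleted [R], the third vertex [w] of the triangle lies on one side
     of the cut, and its edge to the end of [R] on the other side crosses too. *)
  have [w wF wR] : exists2 w, w \in F & w \notin R.
    by apply/subsetPn; apply/negP => /subset_leq_card; rewrite cF cR.
  have uv : u != v.
    by apply/eqP => uv; move: cR; rewrite -uvR uv setUid cards1.
  have [uF' vF'] : u \in F /\ v \in F.
    by split; apply: (subsetP RF); rewrite -uvR !inE eqxx ?orbT.
  have [wu wv] : w != u /\ w != v.
    by split; apply: contraNneq wR => ->; rewrite -uvR !inE eqxx ?orbT.
  have wA := subsetP FA w wF.
  have edge z : z \in F -> w != z -> [set w; z] \in E :\ R.
    move=> zF wz; rewrite in_setD1; apply/andP; split.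
      by apply: contraNneq wR => <-; rewrite !inE eqxx.
    by apply: (cl F) => //; rewrite ?subUset ?sub1set ?wF // cards2 wz.
  have [wS|wS] := boolP (w \in S).
    by exists w, v; split; rewrite ?in_setI ?wA // edge.
  by exists u, w; split=> //; [rewrite in_setD wS | rewrite setUC edge].
- move=> F' e; rewrite !inE => /andP[F'F F'T] eF' ce; rewrite (cl F') // andbT.
  by apply: contraNneq F'F => eR; rewrite (uF F') // -eR.
- by move=> F'; rewrite inE => /andP[_ /cT].
by move=> T' sT'; apply: free; apply: subset_trans sT' (subsetDl _ _).
Qed.

(** Triangles inside [A] never include [G], so every nonempty set of them has a boundary edge, and
    such an edge is free. *)
Lemma surface_collapse X A G : normal_pm 2 X -> linked (esub X A) A ->
  G \in facets 2 X -> ~~ (G \subset A) -> #|A| + #|tri X A 3| <= #|esub X A|.+1.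
Proof.
move=> nX lA GX GA; have cX := npm_complex nX.
have t3 F : F \in tri X A 3 -> [/\ F \in facets 2 X, F \in X, #|F| = 3 & F \subset A].
  rewrite inE => /andP[FX cFA]; have := FX; rewrite in_facets => /andP[FX' /eqP cF].
  by split; rewrite ?FX' ?cF //; apply/setIidPl/eqP; rewrite eqEcard subsetIl cF (eqP cFA).
apply: collapse_bound => //.
- move=> F e /t3[_ FX _ FA] eF ce.
  by rewrite inE (cX _ _ FX eF) ce (subset_trans eF FA).
- by move=> F /t3[].
move=> T' sT' /set0Pn[F FT'].
have sT : T' \subset facets 2 X by apply/subsetP=> H /(subsetP sT')/t3[].
have [R] := bd_neq0 nX sT FT' GX (contra (fun h => let: And4 _ _ _ k := t3 _ (subsetP sT' _ h) in k) GA).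
rewrite inE => /and3P[_ /eqP cR /cards1P[H HR]].
have : H \in [set F in T' | R \subset F] by rewrite HR set11.
rewrite inE => /andP[HT RH]; exists R, H; split=> // F' F'T RF'.
by apply/set1P; rewrite -HR inE F'T.
Qed.

(** The triangles meeting [A] form a chain with nonzero boundary. A boundary edge avoids [A], hence
    is opposite the single vertex of its triangle in [A]; and a nonzero cycle in a graph has at
    least three edges. *)
Lemma surface_fringe X A F G : normal_pm 2 X -> F \in facets 2 X ->
  ~~ [disjoint F & A] -> G \in facets 2 X -> [disjoint G & A] -> 3 <= #|tri X A 1|.
Proof.
move=> nX FX mF GX dG; have cX := npm_complex nX.
pose T := [set H in facets 2 X | ~~ [disjoint H & A]].
have sT : T \subset facets 2 X by apply/subsetP=> H; rewrite inE => /andP[].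
have FT : F \in T by rewrite inE FX.
have GT : G \notin T by rewrite inE GX dG.
have bdP R : R \in bd 2 X T -> #|R| = 2 /\ exists2 H, H \in tri X A 1 & R = H :\: A.
  rewrite inE => /and3P[RX /eqP cR /cards1P[H HR]]; split=> //.
  have : H \in [set F in T | R \subset F] by rewrite HR set11.
  rewrite !inE => /andP[/andP[/andP[HX /eqP cH] mH] RH].
  have dR : [disjoint R & A].
    apply: contraT => mR; have := npm_ridge nX RX cR.
    suff -> : [set F in facets 2 X | R \subset F] = [set F in T | R \subset F].
      by rewrite HR cards1.
    apply/setP=> K; rewrite !inE -andbA; case: (boolP (R \subset K)) => RK; rewrite ?andbF //.
    rewrite !andbT; case: (K \in X) => //=; case: (_ == _) => //=; apply/esym.
    by apply: contra mR; apply: disjointWl.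
  have sR : R \subset H :\: A by rewrite subsetD RH.
  have := cardsID A H; rewrite cH => c.
  have : 0 < #|H :&: A| by rewrite card_gt0 setI_eq0.
  have := subset_leq_card sR; rewrite cR => c2 c3.
  exists H; first by rewrite !inE HX cH /=; apply/eqP; natlia.
  by apply/eqP; rewrite eqEcard sR cR; natlia.
suff : 3 <= #|bd 2 X T|.
  move/leq_trans; apply; apply: leq_trans (leq_imset_card (fun H => H :\: A) _).
  apply: subset_leq_card; apply/subsetP=> R /bdP[_ [H Ht ->]].
  by apply/imsetP; exists H.
have [R RT] := bd_neq0 nX sT FT GX GT.
(* Evenness of the boundary at the ends [b] and [c] of [R] gives one further edge at each; were
   these two equal, they would be [R] itself. *)
have [cR _] := bdP R RT; have /cards2P[b [c [bc Rbc]]] : #|R| == 2 by rewrite cR.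
have other x : x \in R -> exists R', [/\ R' \in bd 2 X T, x \in R', R' != R & #|R'| = 2].
  move=> xR; have [|| R' [R'T xR' nR']] := bd_other (a := [set x]) nX sT RT.
  - by rewrite sub1set.
  - by rewrite cards1.
  by exists R'; split; rewrite // -?sub1set //; case: (bdP R' R'T).
have [R1 [R1T bR1 nR1 cR1]] : exists R', [/\ R' \in bd 2 X T, b \in R', R' != R & #|R'| = 2].
  by apply: other; rewrite Rbc !inE eqxx.
have [R2 [R2T cR2 nR2 cR2']] : exists R', [/\ R' \in bd 2 X T, c \in R', R' != R & #|R'| = 2].
  by apply: other; rewrite Rbc !inE eqxx orbT.
have n12 : R1 != R2.
  apply: contraNneq nR1 => e12; rewrite eq_sym eqEcard cR1 cR andbT Rbc.
  by rewrite subUset !sub1set bR1 e12 cR2.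
have : [set R; R1; R2] \subset bd 2 X T.
  by rewrite !subUset !sub1set RT R1T R2T.
move/subset_leq_card; rewrite -setUA cardsU1 cards2 !inE n12 negb_or.
by rewrite eq_sym nR1 eq_sym nR2.
Qed.

Lemma unlinked E A : linked E A \/ exists S x y, [/\ x \in A :&: S, y \in A :\: S &
  forall u v, u \in A :&: S -> v \in A :\: S -> [set u; v] \notin E].
Proof.
pose bad S := [&& A :&: S != set0, A :\: S != set0 &
  [forall u in A :&: S, forall v in A :\: S, [set u; v] \notin E]].
have [/existsP[S /and3P[/set0Pn[x xS] /set0Pn[y yS] /forall_inP h]]|] := boolP [exists S, bad S].
  right; exists S, x, y; split=> // u v uS vS.
  by have /forall_inP := h u uS; apply.
rewrite negb_exists => /forallP good; left=> S x y xA xS yA yS.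
have := good S; rewrite /bad !negb_and !negbK.
case/or3P=> [/eqP/setP/(_ x)|/eqP/setP/(_ y)|]; rewrite ?inE ?xA ?xS ?yA ?(negPf yS) //.
rewrite negb_forall_in => /exists_inP[u uS]; rewrite negb_forall_in.
by case/exists_inP=> v vS; rewrite negbK => uv; exists u, v.
Qed.

(** For connected [A], Euler's formula gives [3 * (#|esub X A| - #|tri X A 3|) + #|tri X A 1|] edges
    meeting [A]: the collapse makes the bracket at least [#|A| - 1], and the fringe supplies the
    remaining 3. Otherwise [A] splits into two parts with no edge between them, and the inductive
    bounds add. *)
Lemma rigid_surface X : normal_pm 2 X -> rigid 3 2 X.
Proof.
move=> nX; have cX := npm_complex nX; split; first exact: npm_connected nX.
move=> A; elim: {A}_.+1 {-2}A (ltnSn #|A|) => // n IH A An sA [G /andP[GX cG] dG].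
have GF : G \in facets 2 X by rewrite in_facets GX.
have [A0|/set0Pn[r rA]] := eqVneq A set0; first by rewrite A0 cards0 muln0.
have [lA|[S [x [y [xS yS cr]]]]] := unlinked (esub X A) A.
  have GA : ~~ (G \subset A).
    apply/negP=> GA; have := disjointWl GA dG; rewrite -setI_eq0 setIid => /eqP G0.
    by rewrite G0 cards0 in cG.
  have h1 := surface_collapse nX lA GF GA.
  have [F FX rF] : exists2 F, F \in facets 2 X & r \in F.
    have := subsetP sA r rA; rewrite verticesP // => /(npm_ext nX)[F FX].
    by rewrite sub1set; exists F.
  have h2 : 3 <= #|tri X A 1|.
    apply: (surface_fringe nX FX _ GF); last by rewrite disjoint_sym.
    by apply/negP => /(disjointFr); move/(_ _ rF); rewrite rA.
  have := surface_euler A nX; have := card_edges_meeting X A; natlia.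
have IHc B : B \proper A -> 3 * #|B| <= #|edges_meeting X B|.
  move=> BA; apply: IH; first by apply: leq_trans (proper_card BA) _.
    by apply: subset_trans sA; apply: proper_sub.
  by exists G; rewrite ?GX // (disjointWl _ dG) // proper_sub.
have h1 : 3 * #|A :&: S| <= #|edges_meeting X (A :&: S)|.
  apply: IHc; rewrite properE subsetIl; apply/subsetPn; exists y.
    by move: yS; rewrite inE => /andP[].
  by move: yS; rewrite !inE => /andP[/negPf ->]; rewrite andbF.
have h2 : 3 * #|A :\: S| <= #|edges_meeting X (A :\: S)|.
  apply: IHc; rewrite properE subsetDl; apply/subsetPn; exists x.
    by move: xS; rewrite inE => /andP[].
  by move: xS; rewrite !inE => /andP[_ ->].
rewrite -(cardsID S A) mulnDr; apply: leq_trans (leq_add h1 h2) _.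
have sm B : B \subset A -> edges_meeting X B \subset edges_meeting X A.
  move=> BA; apply/subsetP=> e; rewrite !inE => /and3P[-> -> m] /=.
  by apply: contra m; apply: disjointWr.
apply: card_disjoint_sub; rewrite ?sm ?subsetIl ?subsetDl //.
rewrite disjoints_subset; apply/subsetP=> e; rewrite !inE => /and3P[eX ce m1].
rewrite eX ce /= negbK; apply: contraT => m2.
move: m1 m2; rewrite -!setI_eq0 => /set0Pn[u /setIP[ue uS]] /set0Pn[v /setIP[ve vS]].
have uv : u != v by apply: contraTneq uS => ->; move: vS; rewrite !inE => /andP[/negPf ->]; rewrite andbF.
have ee : [set u; v] = e.
  by apply/eqP; rewrite eqEcard subUset !sub1set ue ve (eqP ce) cards2 uv.
case/negP: (cr u v uS vS); rewrite ee inE eX ce -ee subUset !sub1set.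
by move: uS vS; rewrite !inE => /andP[-> _] /andP[_ ->].
Qed.

End Surfaces.

(** * Tight complexes and cutting along a missing facet *)

Section Caps.
Variable V : finType.
Implicit Types (X T E : {set {set V}}) (A B F R S a e s U W : {set V}) (d : nat).

Lemma npm_rigid d X : 1 < d -> normal_pm d X -> rigid d.+1 d X.
Proof.
case: d => [|[|d]] // _; elim: d X => [|d IH] X nX; first exact: rigid_surface.
apply: rigid_step => // w wX; apply: IH; exact: npm_vlink.
Qed.

Lemma binS2 d : 'C(d.+2, 2) = 'C(d.+1, 2) + d.+1.
Proof. by rewrite binS bin1. Qed.

Lemma bin_sq d : 'C(d.+1, 2) + 'C(d.+2, 2) = d.+1 * d.+1.
Proof. by elim: d => // d IH; rewrite (binS2 d.+1); move: IH; rewrite (binS2 d); natlia. Qed.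

(** The case [x = y] makes every element of [W] a vertex of [X]. *)
Definition clique X W := forall x y, x \in W -> y \in W -> [set x; y] \in X.

Lemma clique_face X F : is_complex X -> F \in X -> clique X F.
Proof. by move=> cX FX x y xF yF; apply: cX FX _; rewrite subUset !sub1set xF. Qed.

Lemma esub_clique X W : clique X W -> #|esub X W| = 'C(#|W|, 2).
Proof.
move=> cl; rewrite -cards_draws; apply: eq_card => e; rewrite !inE.
apply/and3P/andP=> [[_ -> ->]//|[eW ce]]; split=> //.
have /cards2P[x [y [_ exy]]] := ce; rewrite exy; apply: cl; apply: (subsetP eW);
  by rewrite exy !inE eqxx ?orbT.
Qed.

(** Rigidity applied to the vertices outside [W], a set that avoids the facet [F]. *)
Lemma npm_outside d X W F : 1 < d -> normal_pm d X -> F \in facets d X ->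
  F \subset W -> W \subset vertices X ->
  d.+1 * #|vertices X :\: W| + #|esub X W| <= #|edges X|.
Proof.
move=> d1 nX FX FW WV; have [_ rX] := npm_rigid d1 nX.
rewrite -(card_edges_meeting X (vertices X :\: W)).
have -> : esub X (~: (vertices X :\: W)) = esub X W.
  apply/setP=> e; rewrite !inE; case: (boolP (e \in X)) => //= eX; congr (_ && _).
  apply/subsetP/subsetP => h x xe; have := h x xe; rewrite !inE ?negb_and ?negbK.
    by rewrite (subsetP (face_vertices eX) x xe) orbF.
  by move=> ->.
rewrite leq_add2r; apply: rX; first exact: subsetDl.
exists F; first by rewrite -in_facets.
rewrite disjoint_sym disjoints_subset; apply: subset_trans FW _.
by apply/subsetP=> x xW; rewrite !inE xW.
Qed.

(** The lower bound theorem: [npm_outside] with [W] a facet, whose own edges number ['C(d.+1, 2)];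
    [bin_sq] gives the constant. *)
Lemma npm_lower d X : 1 < d -> normal_pm d X ->
  d.+1 * #|vertices X| <= #|edges X| + 'C(d.+2, 2).
Proof.
move=> d1 nX; have [F FX] := npm_facet nX; have cX := npm_complex nX.
have := FX; rewrite in_facets => /andP[FX' /eqP cF].
have FV := face_vertices FX'; have := npm_outside d1 nX FX (subxx F) FV.
rewrite (esub_clique (clique_face cX FX')) cF cardsDS // cF.
have := bin_sq d; have := subset_leq_card FV; rewrite cF mulnBr; natlia.
Qed.

(** Equality in [npm_lower], with the subtraction moved to the other side; for [1 < d] the rigidity
    clause of [min_rigid] comes from [npm_rigid]. *)
Definition tight d X := normal_pm d X /\ #|edges X| + 'C(d.+2, 2) = d.+1 * #|vertices X|.

Lemma tight_min_rigid d X : 1 < d -> tight d X <-> normal_pm d X /\ min_rigid d.+1 d X.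
Proof.
move=> d1; have eqv : normal_pm d X ->
    #|edges X| + 'C(d.+2, 2) = d.+1 * #|vertices X| <->
    #|edges X| = (#|vertices X| - d - 1) * d.+1 + 'C(d.+1, 2).
  move=> nX; have [F] := npm_facet nX; rewrite in_facets => /andP[FX /eqP cF].
  have := subset_leq_card (face_vertices FX); rewrite cF => /subnKC <-.
  rewrite -subnDA addn1 addKn mulnDr -(bin_sq d) [d.+1 * _]mulnC.
  by split=> h; natlia.
split=> [[nX eX]|[nX [_ eX]]]; split=> //; last exact/eqv.
by split; [exact: npm_rigid | exact/eqv].
Qed.

(** The vertices outside [W] already claim [d.+1] edges each, and equality leaves only the rest for
    [W]. *)
Lemma tight_upper d X W F : 1 < d -> tight d X -> F \in facets d X -> F \subset W ->
  W \subset vertices X -> #|esub X W| + 'C(d.+2, 2) <= d.+1 * #|W|.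
Proof.
move=> d1 [nX eX] FX FW WV; have := npm_outside d1 nX FX FW WV.
rewrite cardsDS // mulnBr; have := subset_leq_card WV.
by rewrite -(leq_pmul2l (ltn0Sn d)); natlia.
Qed.

(** A minimal nonface; those of size [d.+1] are the missing facets. *)
Definition missing X s := s \notin X /\ forall B, B \proper s -> B \in X.

Definition separates X s A B := [/\ A != set0, B != set0, A :|: B :|: s = vertices X,
  [/\ [disjoint A & s], [disjoint B & s] & [disjoint A & B]] &
  forall u v, u \in A -> v \in B -> [set u; v] \notin X].

Definition cap X s A : {set {set V}} := [set F in X | F \subset A :|: s] :|: [set s].

Lemma separates_sym X s A B : separates X s A B -> separates X s B A.
Proof.
case=> A0 B0 AB [As Bs dAB] ne; split; rewrite // 1?[B :|: A]setUC //.
  by split; rewrite // disjoint_sym.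
by move=> u v uB vA; rewrite setUC ne.
Qed.

Lemma in_cap X s A F : (F \in cap X s A) = (F == s) || (F \in X) && (F \subset A :|: s).
Proof. by rewrite !inE orbC. Qed.

Lemma missing_clique X s : 2 < #|s| -> missing X s -> clique X s.
Proof.
move=> s3 [_ ms] x y xs ys; apply: ms; rewrite properE subUset !sub1set xs ys /=.
by apply/negP=> /subset_leq_card h; have := leq_trans s3 h; rewrite cards2; case: (x != y).
Qed.

Section Cap.
Variables (d : nat) (X : {set {set V}}) (s A B : {set V}).
Hypotheses (d1 : 1 < d) (nX : normal_pm d X) (cs : #|s| = d.+1) (ms : missing X s).
Hypothesis sep : separates X s A B.
Let cX := npm_complex nX.

Lemma face_side F : F \in X -> ~~ [disjoint F & A] -> F \subset A :|: s.
Proof.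
case: sep => _ _ eV _ ne FX /pred0Pn[u /andP[/= uF uA]].
apply/subsetP=> v vF; have : v \in vertices X by apply: (subsetP (face_vertices FX)).
rewrite -eV !inE => /orP[/orP[->//|vB]|->]; last by rewrite orbT.
by have := clique_face cX FX uF vF; rewrite (negPf (ne u v uA vB)).
Qed.

Lemma not_sub_side a : a \subset A :|: s -> ~~ (a \subset s) -> ~~ [disjoint a & A].
Proof.
move=> aAs /subsetPn[x xa xs]; apply/pred0Pn; exists x; rewrite /= xa /=.
by have := subsetP aAs x xa; rewrite inE (negPf xs) orbF.
Qed.

Let TA := [set F in facets d X | ~~ [disjoint F & A]].

Lemma facet_meets F v : v \in F -> v \in A -> ~~ [disjoint F & A].
Proof. by move=> vF vA; apply/pred0Pn; exists v; rewrite /= vF. Qed.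

Lemma vertex_facet v : v \in vertices X -> exists2 F, F \in facets d X & v \in F.
Proof.
by rewrite verticesP // => /(npm_ext nX)[F FX]; rewrite sub1set; exists F.
Qed.

(** A ridge that meets [A] has both its facets in [TA]. So a boundary ridge avoids [A], and being in
    a face on the side of [A] it lies in [s]. *)
Lemma bd_side R : R \in bd d X TA -> R \subset s /\ #|R| = d.
Proof.
rewrite inE => /and3P[RX /eqP cR /cards1P[H HR]]; split=> //.
have : H \in [set F in TA | R \subset F] by rewrite HR set11.
rewrite !inE => /andP[/andP[/andP[HX /eqP cH] mH] RH].
have dR : [disjoint R & A].
  apply: contraT => mR; have := npm_ridge nX RX cR.
  suff -> : [set F in facets d X | R \subset F] = [set F in TA | R \subset F].
    by rewrite HR cards1.
  apply/setP=> K; rewrite !inE -andbA; case: (boolP (R \subset K)) => RK; rewrite ?andbF //.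
  rewrite !andbT; case: (K \in X) => //=; case: (_ == _) => //=; apply/esym.
  by apply: contra mR; apply: disjointWl.
apply/subsetP=> x xR; have := subsetP (subset_trans RH (face_side HX mH)) x xR.
by rewrite inE (disjointFr dR xR).
Qed.

(* The boundary of the chain of facets meeting [A] is a nonzero cycle supported in
   the simplex [s], hence consists of all the ridges of [s]. *)
Lemma bd_all R : R \subset s -> #|R| = d -> R \in bd d X TA.
Proof.
case: sep => /set0Pn[x xA] /set0Pn[y yB] eV [As Bs dAB] ne.
have [F FX xF] : exists2 F, F \in facets d X & x \in F.
  by apply: vertex_facet; rewrite -eV !inE xA.
have [G GX yG] : exists2 F, F \in facets d X & y \in F.
  by apply: vertex_facet; rewrite -eV !inE yB orbT.
have sT : TA \subset facets d X by apply/subsetP=> H; rewrite inE => /andP[].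
have FT : F \in TA by rewrite inE FX (facet_meets xF).
have GT : G \notin TA.
  rewrite inE GX negbK; have := GX; rewrite in_facets => /andP[GX' _].
  apply: contraT => /(face_side GX')/subsetP/(_ y yG).
  by rewrite inE (disjointFl dAB yB) (disjointFr Bs yB).
have [R0 R0T] := bd_neq0 nX sT FT GX GT.
(* Ridges of [s] are coded by the vertex they omit. From [s :\ p] in the boundary, evenness at [s]
   minus [p] and [q] gives a second boundary ridge there, which can only be [s :\ q]. *)
have compl (P : {set V}) : P \subset s -> #|P| = d -> exists2 p, p \in s & P = s :\ p.
  move=> Ps cP; have /cards1P[p ep] : #|s :\: P| == 1 by rewrite cardsDS // cs cP subSnn.
  have : p \in s :\: P by rewrite ep set11.
  rewrite inE => /andP[pP ps]; exists p => //.
  by rewrite -ep setDDr setDv set0U; apply/esym/setIidPr.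
have [R0s cR0] := bd_side R0T; have [p ps eR0] := compl _ R0s cR0.
move=> Rs cR; have [q qs eR] := compl _ Rs cR.
have [qp|qp] := eqVneq q p; first by rewrite eR qp -eR0.
have ca : #|R0 :\ q| = d.-1.
  by have := cardsD1 q R0; rewrite cR0 {1}eR0 !inE qp qs add1n => ->.
have [R' [R'T aR' nR']] := bd_other nX sT R0T (subsetDl _ _ : R0 :\ q \subset R0) ca.
have [R's cR'] := bd_side R'T; have [r rs eR'] := compl _ R's cR'.
suff <- : R' = R by [].
rewrite eR' eR; congr (_ :\ _); have rp : r != p.
  by apply: contraNneq nR' => rp; rewrite eR' eR0 rp.
apply/eqP; apply: contraT => rq; have := subsetP aR' r.
by rewrite eR' eR0 !inE eqxx rq rp rs => /(_ isT).
Qed.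

Lemma cap_complex : is_complex (cap X s A).
Proof.
move=> F G; rewrite !in_cap => /orP[/eqP-> Gs|/andP[FX FA] GF]; last first.
  by rewrite (cX FX GF) (subset_trans GF FA) orbT.
have [//|nG] := eqVneq G s; case: ms => _ /(_ G) ->.
  by rewrite (subset_trans Gs) ?subsetUr.
by rewrite properEneq nG.
Qed.

Lemma cap_side F : F \in X -> ~~ [disjoint F & A] -> F \in cap X s A.
Proof. by move=> FX mF; rewrite in_cap FX face_side ?orbT. Qed.

Lemma facets_cap F : (F \in facets d (cap X s A)) = (F == s) || (F \in TA).
Proof.
rewrite in_facets in_cap; have [->|ns] /= := eqVneq F s; first by rewrite cs eqxx.
rewrite [RHS]inE in_facets -!andbA; case: (boolP (F \in X)) => //= FX.
have [cF|] := eqVneq #|F| d.+1; last by rewrite andbF.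
rewrite andbT /=; apply/idP/idP => [FA|]; last exact: face_side.
apply: not_sub_side => //; apply: contra ns => Fs.
by rewrite eqEcard Fs cF cs /=.
Qed.

(** A ridge inside [s] has one facet on the side of [A], by [bd_all], and [s] as the second; any
    other ridge keeps its two facets. Links of faces not inside [s] are unchanged; for a face inside
    [s] the link is held together by the vertices of [s], which are now pairwise joined in it. *)
Lemma cap_npm : normal_pm d (cap X s A).
Proof.
have [/set0Pn[x0 x0A] _ eV [As Bs dAB] ne] := sep; have [sX prs] := ms.
have sA F : F \in cap X s A -> F \subset A :|: s.
  by rewrite in_cap => /orP[/eqP->|/andP[]//]; rewrite subsetUr.
have scap : s \in cap X s A by rewrite in_cap eqxx.
apply: npmI; first exact: ltnW; first exact: cap_complex.
- by rewrite in_cap (npm_set0 nX) sub0set orbT.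
- move=> F FX; have [Fs|nFs] := boolP (F \subset s).
    by exists s => //; rewrite facets_cap eqxx.
  have mF := not_sub_side (sA F FX) nFs.
  have FX' : F \in X.
    by move: FX; rewrite in_cap => /orP[/eqP Fs|/andP[]//]; rewrite Fs subxx in nFs.
  have [G GX FG] := npm_ext nX FX'; exists G => //.
  rewrite facets_cap inE GX; apply/orP; right=> /=.
  by apply: contra mF; apply: disjointWl.
- move=> R RX cR; have [Rs|nRs] := boolP (R \subset s).
    have := bd_all Rs cR; rewrite inE => /and3P[_ _ /eqP c1].
    have -> : [set F in facets d (cap X s A) | R \subset F] = s |: [set F in TA | R \subset F].
      apply/setP=> F; rewrite [LHS]inE facets_cap in_setU1.
      have [->|_] := eqVneq F s; first by rewrite Rs.
      by rewrite /= [RHS]inE.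
    rewrite cardsU1 c1; case: (boolP (s \in _)) => // sT; case/negP: sX.
    by move: sT; rewrite inE => /andP[]; rewrite inE in_facets => /andP[/andP[]].
  have mR := not_sub_side (sA R RX) nRs.
  have RX' : R \in X.
    by move: RX; rewrite in_cap => /orP[/eqP Rs|/andP[]//]; rewrite Rs subxx in nRs.
  rewrite -(npm_ridge nX RX' cR); apply: eq_card => F.
  rewrite [LHS]inE [RHS]inE facets_cap.
  case: (boolP (R \subset F)) => RF; rewrite ?andbF //.
  have -> : (F == s) = false by apply: contraNF nRs => /eqP <-.
  rewrite inE /= !andbT andb_idr // => _.
  by apply: contra mR; apply: disjointWl.
move=> a acap ca S u v ua va uX vX uS cl.
have [as_|nas] := boolP (a \subset s); last first.
  have ma := not_sub_side (sA a acap) nas.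
  have nb F : a \subset F -> (F \in cap X s A) = (F \in X).
    move=> aF; apply/idP/idP => [|FX]; last first.
      by apply: cap_side => //; apply: contra ma; apply: disjointWl.
    by rewrite in_cap => /orP[/eqP Fs|/andP[]//]; rewrite Fs (negPf nas) in aF.
  have aX : a \in X by rewrite -nb.
  rewrite !nb ?subsetUr // in uX vX.
  apply: (npm_conn nX aX ca ua va uX vX uS) => x y xS xa ya xyX.
  by apply: (cl x y); rewrite ?nb // subsetUl.
have psub (P : {set V}) : P \subset s -> #|P| < #|s| -> P \in X.
  by move=> Ps cP; apply: prs; rewrite properEcard Ps.
have aX : a \in X by apply: psub => //; rewrite cs; natlia.
have pX p : p \in s -> p \notin a -> p |: a \in X.
  move=> ps pa; apply: psub; first by rewrite subUset sub1set ps.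
  by rewrite cardsU1 pa cs; natlia.
have [p ps pa] : exists2 p, p \in s & p \notin a.
  by apply/subsetPn/negP => /subset_leq_card; rewrite cs; natlia.
have inX w : w \in A -> w |: a \in cap X s A -> w |: a \in X.
  move=> wA; rewrite in_cap => /orP[/eqP ws|/andP[]//].
  by have := disjointFr As wA; rewrite -ws setU11.
(* A walk in the link within [X] from [A] to [p] must leave [A], and as no edge joins [A] to [B] it
   leaves into [s]. Up to there it stays in the cap. *)
have reach S' w : w \in A -> w \notin a -> w |: a \in cap X s A -> w \in S' ->
    (forall x y, x \in S' -> x \notin a -> y \notin a -> a :|: [set x; y] \in cap X s A -> y \in S') ->
    exists q, [/\ q \in s, q \notin a & q \in S'].
  move=> wA wa wX wS cl'.
  have [/existsP[q /and3P[qs qa qS]]|none] := boolP [exists q, [&& q \in s, q \notin a & q \in S']].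
    by exists q.
  have : p \in S' :&: A.
    apply: (npm_conn nX aX ca wa pa (inX w wA wX) (pX p ps pa)); first by rewrite inE wS.
    move=> x y /setIP[xS xA] xa ya xyX.
    have xyc : a :|: [set x; y] \in cap X s A.
      by apply: cap_side => //; apply: (@facet_meets _ x); rewrite // !inE eqxx orbT.
    have yS := cl' x y xS xa ya xyc; rewrite inE yS /=.
    have : y \in A :|: s by apply: (subsetP (sA _ xyc)); rewrite !inE eqxx !orbT.
    rewrite inE => /orP[//|ys]; case/negP: none; apply/existsP; exists y.
    by rewrite ys ya.
  by rewrite inE (disjointFl As ps) andbF.
have [q [qs qa qS]] : exists q, [/\ q \in s, q \notin a & q \in S].
  have : u \in A :|: s by apply: (subsetP (sA _ uX)); rewrite setU11.
  rewrite inE => /orP[uA|us]; first exact: (reach S u).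
  by exists u.
have allS r : r \in s -> r \notin a -> r \in S.
  move=> rs ra; apply: (cl q) => //; apply: cap_complex scap _.
  by rewrite !subUset !sub1set as_ qs rs.
have : v \in A :|: s by apply: (subsetP (sA _ vX)); rewrite setU11.
rewrite inE => /orP[vA|vs]; last exact: allS.
(* Closure along edges is symmetric, so it passes to the complement of [S]; from [v] this complement
   would also reach [s], which lies in [S]. *)
apply: contraT => vS; have [||r [rs ra]] := reach (~: S) v vA va vX.
- by rewrite inE.
- move=> x y; rewrite !in_setC => xS xa ya xyc; apply: contra xS => yS.
  by apply: (cl y x) => //; rewrite [[set y; x]]setUC.
by rewrite inE allS.
Qed.

Lemma vertices_cap : vertices (cap X s A) = A :|: s.
Proof.
have [_ _ eV _ _] := sep.
apply/setP=> v; rewrite verticesP; last exact: cap_complex.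
rewrite in_cap sub1set -verticesP // -eV !inE.
have -> : ([set v] == s) = false.
  by apply/eqP => vs; have := cs; rewrite -vs cards1; move: d1; natlia.
by rewrite /=; case: (v \in A); case: (v \in B); case: (v \in s).
Qed.

Lemma edges_cap : edges (cap X s A) = esub X (A :|: s).
Proof.
apply/setP=> e; rewrite !inE; have [->|_] := eqVneq e s; last first.
  by rewrite orbF -!andbA; case: (e \in X); rewrite //= andbC.
rewrite orbT cs; case: eqP => [|_]; last by rewrite /= andbF.
by move: d1; natlia.
Qed.

Lemma cap_lower : d.+1 * #|A :|: s| <= #|esub X (A :|: s)| + 'C(d.+2, 2).
Proof. by rewrite -edges_cap -vertices_cap; apply: npm_lower d1 cap_npm. Qed.

End Cap.

Lemma card_sep_edges d X s A B : 1 < d -> normal_pm d X -> #|s| = d.+1 -> missing X s ->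
  separates X s A B ->
  #|esub X (A :|: s)| + #|esub X (B :|: s)| = #|edges X| + 'C(d.+1, 2).
Proof.
move=> d1 nX cs ms sep; have [_ _ eV [As Bs dAB] ne] := sep.
rewrite -cardsUI -esubI -cs -(@esub_clique X s); last first.
  by apply: missing_clique => //; rewrite cs; move: d1; natlia.
have -> : (A :|: s) :&: (B :|: s) = s.
  by rewrite -setUIl; move: dAB; rewrite -setI_eq0 => /eqP ->; rewrite set0U.
suff -> : esub X (A :|: s) :|: esub X (B :|: s) = edges X by [].
apply/setP=> e; rewrite !inE -!andb_orr; case: (boolP (e \in X)) => //= eX.
case: eqP => //= _; rewrite ?andbT; have [dA|mA] := boolP [disjoint e & A]; last first.
  by rewrite (face_side nX sep).
apply/orP; right; apply/subsetP=> x xe; have := subsetP (face_vertices eX) x xe.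
by rewrite -eV !inE (disjointFr dA xe).
Qed.

(** Both caps satisfy [npm_lower], and by [card_sep_edges] and [bin_sq] the two bounds add up
    exactly to the edge count of [X]; hence both are equalities. *)
Lemma tight_cap d X s A B : 1 < d -> tight d X -> #|s| = d.+1 -> missing X s ->
  separates X s A B -> tight d (cap X s A).
Proof.
move=> d1 [nX eX] cs ms sep; split; first exact: cap_npm sep.
rewrite (vertices_cap (d := d) (B := B)) ?(edges_cap (d := d)) //.
have h1 := cap_lower d1 nX cs ms sep.
have h2 := cap_lower d1 nX cs ms (separates_sym sep).
have h3 := card_sep_edges d1 nX cs ms sep.
have [_ _ eV [As Bs dAB] _] := sep.
have cV : #|vertices X| + d.+1 = #|A :|: s| + #|B :|: s|.
  rewrite -cardsUI -setUIl; move: dAB; rewrite -setI_eq0 => /eqP ->; rewrite set0U cs.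
  by rewrite -eV -setUUl.
have := bin_sq d; have := congr1 (muln d.+1) cV; rewrite !mulnDr; natlia.
Qed.

End Caps.

(** * Cliques and missing faces of tight complexes *)

Section Tight.
Variable V : finType.
Implicit Types (X T E Q : {set {set V}}) (A B F G R S a e s U W Z : {set V}) (d : nat).

(** [Q] stands for the edges of a link, or of part of one, possibly with an extra edge; the second
    summand counts the spokes at [w]. *)
Lemma cone_sub X w W Q : is_complex X -> w \in W -> W \subset nb X w ->
  (forall e, e \in Q -> [/\ e \in X, #|e| = 2 & e \subset W :\ w]) ->
  #|Q| + #|W :\ w| <= #|esub X W|.
Proof.
move=> cX wW WN hQ; rewrite -(@card_spokes _ w (W :\ w)) ?inE ?eqxx //.
apply: card_disjoint_sub.
- rewrite disjoints_subset; apply/subsetP=> e /hQ[_ _ /subsetP eW]; rewrite inE.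
  by apply/imsetP=> -[x _ ex]; have := eW w; rewrite ex !inE eqxx => /(_ isT).
- apply/subsetP=> e /hQ[eX ce eW]; rewrite inE eX ce (subset_trans eW) //.
  exact: subsetDl.
apply/subsetP=> e /imsetP[x /setD1P[xw xW] ->]; rewrite inE cards2 [w == x]eq_sym xw.
rewrite subUset !sub1set wW xW !andbT setUC.
by have := subsetP WN x xW; rewrite inE.
Qed.

Lemma esub_del X w W : w \in W -> #|esub X W| <= #|esub X (W :\ w)| + #|W :\ w|.
Proof.
move=> wW; rewrite -(@card_spokes _ w (W :\ w)) ?inE ?eqxx //.
apply: leq_trans (leq_card_setU _ _); apply: subset_leq_card; apply/subsetP=> e.
rewrite inE => /and3P[eX ce eW]; rewrite inE [_ \in esub _ _]inE eX ce subsetD1 eW /=.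
have [we|//] := boolP (w \in e); apply/imsetP.
have /cards1P[x ex] : #|e :\ w| == 1 by rewrite (cardsD1 w) we in ce.
have : x \in e :\ w by rewrite ex set11.
move=> /setD1P[xw xe]; exists x; last by rewrite -ex setD1K.
by rewrite !inE xw (subsetP eW).
Qed.

Lemma edges_vlink X w : is_complex X -> forall e, e \in edges (link X [set w]) ->
  [/\ e \in X, #|e| = 2 & e \subset nb X w :\ w].
Proof.
move=> cX e; rewrite inE => /andP[eL /eqP ce]; split=> //.
  by move: eL; rewrite inE => /andP[].
by rewrite -vertices_vlink //; apply: face_vertices.
Qed.

Lemma link_lower d X w : 1 < d -> normal_pm d.+1 X -> [set w] \in X ->
  d.+1 * #|nb X w :\ w| <= #|edges (link X [set w])| + 'C(d.+2, 2).
Proof.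
move=> d1 nX wX; have cX := npm_complex nX.
by rewrite -vertices_vlink //; apply: npm_lower (npm_vlink (ltnW d1) nX wX).
Qed.

Lemma star_lower d X w : 1 < d -> normal_pm d.+1 X -> [set w] \in X ->
  d.+2 * #|nb X w| <= #|esub X (nb X w)| + 'C(d.+3, 2).
Proof.
move=> d1 nX wX; have cX := npm_complex nX; have wN := nb_self wX.
have := cone_sub cX wN (subxx _) (edges_vlink cX); have := link_lower d1 nX wX.
rewrite (cardsD1 w (nb X w)) wN (binS2 d.+1) add1n mulnS mulSn; natlia.
Qed.

Lemma star_upper d X w : 1 < d -> tight d X -> [set w] \in X ->
  #|esub X (nb X w)| + 'C(d.+2, 2) <= d.+1 * #|nb X w|.
Proof.
move=> d1 tX wX; have [nX _] := tX; have [F FX] := npm_ext nX wX; rewrite sub1set => wF.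
apply: (tight_upper d1 tX FX); last exact: nb_vertices.
by apply: face_nb => //; [exact: npm_complex nX | move: FX; rewrite in_facets => /andP[]].
Qed.

(* An edge [x y] outside the link of [w] would be one too many in the closed star. *)
Lemma no_missing_triangle d X w x y : 1 < d -> tight d.+1 X -> [set x; w] \in X ->
  [set y; w] \in X -> [set x; y] \in X -> w |: [set x; y] \in X.
Proof.
move=> d1 tX xw yw xy; have [nX _] := tX; have cX := npm_complex nX.
have wX : [set w] \in X by apply: cX xw _; rewrite sub1set !inE eqxx orbT.
have [->|nxw] := eqVneq x w; first by rewrite setUA setUid setUC.
have [->|nyw] := eqVneq y w; first by rewrite setUCA setUid.
have [<-|nxy] := eqVneq x y; first by rewrite setUid setUC.
apply: contraT => nX3; have wN := nb_self wX.
have xyL : [set x; y] \notin edges (link X [set w]).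
  by rewrite inE in_vlink // (negPf nX3) andbF.
have h : #|[set x; y] |: edges (link X [set w])| + #|nb X w :\ w| <= #|esub X (nb X w)|.
  apply: cone_sub => // e; rewrite in_setU1 => /orP[/eqP->|]; last exact: edges_vlink.
  by rewrite cards2 nxy subsetD1 subUset !sub1set !in_nb xw yw !inE negb_or eq_sym nxw eq_sym nyw.
rewrite cardsU1 xyL in h.
have := star_upper (leqW d1) tX wX; have := link_lower d1 nX wX; move: h.
rewrite (cardsD1 w (nb X w)) wN (binS2 d.+1) add1n mulnS mulSn; natlia.
Qed.

(** The lower bound for the link, with the spokes added, equals the upper bound that tightness puts
    on the star. *)
Lemma tight_link d X w : 1 < d -> tight d.+1 X -> [set w] \in X -> tight d (link X [set w]).
Proof.
move=> d1 tX wX; have [nX _] := tX; have cX := npm_complex nX; have wN := nb_self wX.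
split; first exact: npm_vlink (ltnW d1) nX wX.
have := cone_sub cX wN (subxx _) (edges_vlink cX); have := link_lower d1 nX wX.
have := star_upper (leqW d1) tX wX; rewrite vertices_vlink //.
rewrite (cardsD1 w (nb X w)) wN (binS2 d.+1) add1n mulnS mulSn; natlia.
Qed.

(** Induction through the link of a vertex [w] of [W]: by [no_missing_triangle] the rest of [W] is a
    clique there. In dimension 2 only vertices and edges are at stake. *)
Lemma clique_small d X W : 1 < d -> tight d X -> clique X W -> #|W| <= d -> W \in X.
Proof.
case: d => [|[|d]] // _; elim: d X W => [|d IH] X W tX cl cW.
  have [->|/set0Pn[w wW]] := eqVneq W set0; first by have [/npm_set0] := tX.
  have := cardsD1 w W; rewrite wW => e.
  have [W0|/set0Pn[v]] := eqVneq (W :\ w) set0.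
    by rewrite -(setD1K wW) W0 setU0 -[[set w]]setUid; apply: cl.
  move=> /setD1P[vw vW]; suff <- : [set v; w] = W by apply: cl.
  by apply/eqP; rewrite eqEcard subUset !sub1set vW wW cards2 vw.
have [nX _] := tX; have cX := npm_complex nX.
have [->|/set0Pn[w wW]] := eqVneq W set0; first exact: npm_set0 nX.
have wX : [set w] \in X by rewrite -[[set w]]setUid; apply: cl.
suff : W :\ w \in link X [set w] by rewrite in_vlink // setD1K // => /andP[].
apply: IH; first exact: tight_link tX wX.
  move=> x y /setD1P[xw xW] /setD1P[yw yW].
  rewrite in_vlink // !inE negb_or eq_sym xw eq_sym yw /=.
  by apply: (no_missing_triangle _ tX) => //; apply: cl.
by have := cardsD1 w W; rewrite wW; natlia.
Qed.

Lemma clique_missing d X s : 1 < d -> tight d X -> clique X s -> #|s| = d.+1 ->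
  s \notin X -> missing X s.
Proof.
move=> d1 tX cl cs sX; split=> // B Bs; apply: (clique_small d1 tX).
  by move=> x y xB yB; apply: cl; apply: (subsetP (proper_sub Bs)).
by rewrite -ltnS -cs proper_card.
Qed.

(** A ridge inside [Z] lies in two [d.+1]-subsets of [Z], both faces, so the facets inside [Z] form
    a chain without boundary; hence they are all the facets. *)
Lemma std_sphere_crit d X Z : normal_pm d X -> #|Z| = d.+2 ->
  (forall F, F \subset Z -> #|F| = d.+1 -> F \in X) -> X = std_sphere Z.
Proof.
move=> nX cZ hZ; have cX := npm_complex nX.
have big B : B \proper Z -> exists2 F, F \in facets d X & (B \subset F) && (F \subset Z).
  move=> /properP[BZ [z zZ zB]]; exists (Z :\ z); last by rewrite subsetD1 BZ zB subsetDl.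
  have cF : #|Z :\ z| = d.+1 by have := cardsD1 z Z; rewrite zZ cZ add1n => -[].
  by rewrite in_facets cF eqxx andbT hZ // subsetDl.
pose T := [set F in facets d X | F \subset Z].
have sT : T \subset facets d X by apply/subsetP=> F; rewrite inE => /andP[].
have TZ F : F \in facets d X -> F \subset Z.
  move=> FX; apply: contraT => FZ.
  have [G GX /andP[_ GZ]] : exists2 F, F \in facets d X & (set0 \subset F) && (F \subset Z).
    by apply: big; rewrite proper0 -card_gt0 cZ.
  have GT : G \in T by rewrite inE GX.
  have FT : F \notin T by rewrite inE (negPf FZ) andbF.
  have [R] := bd_neq0 nX sT GT FX FT; rewrite inE => /and3P[RX /eqP cR /cards1P[H HR]].
  have : H \in [set F in T | R \subset F] by rewrite HR set11.
  rewrite 2!inE => /andP[/andP[_ HZ] RH].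
  have := card_between (subset_trans RH HZ); rewrite cZ cR -addn2 addKn => /eqP.
  suff -> : [set K : {set V} | [&& R \subset K, K \subset Z & #|K| == d.+1]] = [set H].
    by rewrite cards1.
  rewrite -HR; apply/setP=> K; rewrite !inE; apply/and3P/andP.
    by case=> RK KZ cK; rewrite hZ ?cK ?KZ //; apply/eqP.
  by case=> /andP[/andP[_ cK] KZ] RK.
apply/setP=> B; rewrite inE; apply/idP/idP => [BX|/big[F FX /andP[BF _]]].
  have [F FX BF] := npm_ext nX BX; rewrite properEcard (subset_trans BF (TZ F FX)) cZ.
  by rewrite ltnS (npm_dim nX).
by move: FX; rewrite in_facets => /andP[FX _]; apply: cX FX BF.
Qed.

Lemma clique_std d X Z : 1 < d -> tight d X -> clique X Z -> #|Z| = d.+2 ->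
  X = std_sphere Z \/ exists2 s : {set V}, #|s| = d.+1 & missing X s.
Proof.
move=> d1 tX cl cZ; have [nX _] := tX.
have [/existsP[s /and3P[sZ /eqP cs sX]]|none] :=
  boolP [exists s : {set V}, [&& s \subset Z, #|s| == d.+1 & s \notin X]].
  right; exists s => //; apply: (clique_missing d1 tX) => //.
  by move=> x y xs ys; apply: cl; apply: (subsetP sZ).
left; apply: (std_sphere_crit nX) => // F FZ cF; apply: contraR none => FX.
by apply/existsP; exists F; rewrite FZ cF eqxx.
Qed.

Lemma cliqueU X A B : clique X A -> clique X B ->
  (forall (a b : V), a \in A -> b \in B -> [set a; b] \in X) -> clique X (A :|: B).
Proof.
move=> cA cB cAB x y /setUP[xA|xB] /setUP[yA|yB]; [exact: cA|exact: cAB| |exact: cB].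
by rewrite setUC; apply: cAB.
Qed.

(* In dimension 3 the common neighbours of [u] and [v] span at least [2 m - 3] edges,
   while the link of [u v] is a cycle of length [m]: either the cycle has a chord,
   or [m = 3]. *)
Lemma missing_exists3 X : tight 3 X ->
  (exists2 Z : {set V}, #|Z| = 5 & X = std_sphere Z) \/ exists2 s : {set V}, #|s| = 4 & missing X s.
Proof.
move=> tX; have [nX _] := tX; have cX := npm_complex nX.
have [F0 F0X] := npm_facet nX; have := F0X; rewrite in_facets => /andP[F0X' /eqP cF0].
have /card_gt1P[u [v [uF vF uv]]] : 1 < #|F0| by rewrite cF0.
have tri x y z : [set x; y] \in X -> [set x; z] \in X -> [set y; z] \in X ->
    z |: [set x; y] \in X.
  by move=> *; apply: (no_missing_triangle (d := 2) _ tX).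
have uX : [set u] \in X by apply: cX F0X' _; rewrite sub1set.
have vX : [set v] \in X by apply: cX F0X' _; rewrite sub1set.
have uvX : [set u; v] \in X by apply: cX F0X' _; rewrite subUset !sub1set uF.
pose W := nb X u :&: nb X v; pose L := W :\ u :\ v.
have uW : u \in W by rewrite !inE setUid uX uvX.
have vW : v \in W by rewrite !inE setUid vX setUC uvX.
have LP x : x \in L -> [/\ x != u, x != v, [set x; u] \in X & [set x; v] \in X].
  by rewrite !inE => /and4P[].
have LI x : x != u -> x != v -> [set x; u] \in X -> [set x; v] \in X -> x \in L.
  by rewrite !inE => -> -> -> ->.
have cW : #|W| = #|L|.+2.
  by rewrite (cardsD1 u) uW (cardsD1 v) !inE eq_sym uv /= setUid vX setUC uvX.
(* Both stars meet the lower bound, and tightness limits their union; supermodularity leaves the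
   same lower bound, with defect ['C(5, 2) = 10], for the intersection. *)
have lowW : 4 * #|W| <= #|esub X W| + 10.
  have l1 := star_lower (isT : 1 < 2) nX uX; have l2 := star_lower (isT : 1 < 2) nX vX.
  have := esub_super X (nb X u) (nb X v); rewrite -/W.
  have := cardsUI (nb X u) (nb X v); rewrite -/W.
  have := @tight_upper _ 3 X (nb X u :|: nb X v) F0 isT tX F0X.
  rewrite subUset !nb_vertices subsetU ?face_nb //= => /(_ isT isT).
  move: l1 l2; change 'C(5, 2) with 10; natlia.
have upW : #|esub X W| <= #|esub X L| + 2 * #|L| + 1.
  have := esub_del X uW; have vW' : v \in W :\ u by rewrite in_setD1 eq_sym uv vW.
  have := esub_del X vW'; have := cardsD1 u W; rewrite uW cW -/L; natlia.
have lowL : 2 * #|L| <= #|esub X L| + 3 by natlia.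
pose Fa := [set F in facets 3 X | [set u; v] \subset F].
have FaP F : F \in Fa -> [/\ F \in X, #|F| = 4, u \in F & v \in F].
  by rewrite inE in_facets subUset !sub1set => /andP[/andP[-> /eqP->] /andP[]].
have FaL F : F \in Fa -> F :\: [set u; v] \subset L /\ #|F :\: [set u; v]| = 2.
  move=> /FaP[FX cF uF' vF']; split.
    apply/subsetP=> x /setDP[xF]; rewrite in_set2 negb_or => /andP[xu xv]; apply: LI => //;
      by apply: (clique_face cX FX).
  by rewrite cardsDS ?cF ?cards2 ?uv // subUset !sub1set uF'.
(* The facets through [u] and [v] are the edges of the link of [[set u; v]]. Each [x] in [L] spans a
   ridge with [u] and [v], by [no_missing_triangle], so it is in two of them, and each of them has
   two vertices in [L]. *)
have cFa : #|Fa| = #|L|.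
  have : \sum_(x in L) #|[set F in Fa | x \in F]| = \sum_(F in Fa) #|[set x in L | x \in F]|.
    exact: double_count.
  rewrite (eq_bigr (fun=> 2)) => [|x /LP[xu xv xuX xvX]]; last first.
    rewrite -(npm_ridge nX (tri u v x uvX _ _)).
    - apply: eq_card => F; rewrite [LHS]inE [_ \in Fa]inE [RHS]inE -andbA.
      by rewrite [in RHS]setUC [in RHS]subUset sub1set.
    - by rewrite setUC.
    - by rewrite setUC.
    by rewrite cardsU1 cards2 uv !inE negb_or xu xv.
  rewrite [RHS](eq_bigr (fun=> 2)) => [|F FF]; last first.
    have [FL cF] := FaL F FF; rewrite -cF; apply: eq_card => x; rewrite inE.
    apply/andP/idP => [[/LP[xu xv _ _] xF]|xF]; first by rewrite !inE negb_or xu xv.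
    by split; [exact: (subsetP FL) | move: xF; rewrite inE => /andP[]].
  by rewrite !sum_nat_const; natlia.
have L3 : 2 < #|L|.
  have : #|[set F :\: [set u; v] | F in Fa]| <= 'C(#|L|, 2).
    rewrite -cards_draws; apply: subset_leq_card; apply/subsetP=> e /imsetP[F /FaL[FL cF] ->].
    by rewrite inE FL cF.
  rewrite card_in_imset ?cFa => [|F G /FaP[_ _ uF' vF'] /FaP[_ _ uG vG] eFG]; last first.
    have sF (K : {set V}) : u \in K -> v \in K -> K = [set u; v] :|: K :\: [set u; v].
      by move=> uK vK; rewrite -{1}(setID K [set u; v]) (setIidPr _) // subUset !sub1set uK.
    by rewrite (sF F) // eFG -sF.
  have : 0 < #|Fa| by apply/card_gt0P; exists F0; rewrite inE F0X subUset !sub1set uF.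
  by rewrite cFa; case: #|L| => [|[|[|k]]].
have cross (a b : V) : a \in [set u; v] -> b \in L -> [set a; b] \in X.
  by move=> /set2P[->|->] /LP[_ _ h1 h2]; rewrite setUC.
have cluv : clique X [set u; v] by apply: clique_face.
have dL B : B \subset L -> [set u; v] :&: B = set0.
  move=> BL; apply/eqP; rewrite setI_eq0 disjoint_sym disjoints_subset.
  by apply: subset_trans BL _; apply/subsetP=> x /LP[xu xv _ _]; rewrite !inE negb_or xu xv.
(* A chord [e] gives a 4-clique that is no face. Without chords [L] spans at most [#|L|] edges, and
   [lowL] leaves [#|L| <= 3]. *)
have [/existsP[e /and3P[eL ce neX]]|nochord] :=
  boolP [exists e : {set V}, [&& e \in esub X L, #|e| == 2 & [set u; v] :|: e \notin X]].
  move: eL; rewrite inE => /and3P[eX _ eL].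
  have c4 : #|[set u; v] :|: e| = 4 by rewrite cardsU dL // cards0 cards2 uv (eqP ce).
  right; exists ([set u; v] :|: e) => //; apply: (clique_missing _ tX) => //.
  apply: cliqueU => // [|a b auv be]; first exact: clique_face.
  by apply: cross => //; apply: (subsetP eL).
have eLu : #|esub X L| <= #|L|.
  rewrite -cFa -(@card_in_imset _ _ (fun e => [set u; v] :|: e)); last first.
    move=> e f; rewrite !inE => /and3P[_ _ eL] /and3P[_ _ fL] /(congr1 (fun h => h :\: [set u; v])).
    have sub (K : {set V}) : K \subset L -> ([set u; v] :|: K) :\: [set u; v] = K.
      move=> KL; rewrite setDUl setDv set0U; apply/setDidPl.
      by rewrite disjoint_sym -setI_eq0 dL.
    by rewrite !sub.
  apply: subset_leq_card; apply/subsetP=> _ /imsetP[e eE ->].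
  have := eE; rewrite inE => /and3P[eX ce eL].
  have e4X : [set u; v] :|: e \in X.
    by apply: contraR nochord => h; apply/existsP; exists e; rewrite eE ce.
  by rewrite inE in_facets e4X cardsU dL // cards0 cards2 uv (eqP ce) subsetUl.
have L3' : #|L| = 3 by natlia.
have clL : clique X L.
  have sub2 : esub X L \subset [set e : {set V} | e \subset L & #|e| == 2].
    by apply/subsetP=> e; rewrite !inE => /and3P[_ -> ->].
  have /eqP eq2 : esub X L == [set e : {set V} | e \subset L & #|e| == 2].
    by rewrite eqEcard sub2 cards_draws L3'; move: lowL; rewrite L3' (_ : 'C(3, 2) = 3) //; natlia.
  move=> x y xL yL; have [<-|xy] := eqVneq x y.
    by rewrite setUid; have [_ _ h _] := LP x xL; apply: cX h _; rewrite sub1set !inE eqxx.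
  have : [set x; y] \in esub X L by rewrite eq2 inE subUset !sub1set xL yL cards2 xy.
  by rewrite inE => /andP[].
have clZ : clique X ([set u; v] :|: L) by apply: cliqueU.
have c5 : #|[set u; v] :|: L| = 5 by rewrite cardsU dL // cards0 cards2 uv L3'.
have [XZ|] := clique_std (isT : 1 < 3) tX clZ c5; last by right.
by left; exists ([set u; v] :|: L).
Qed.

(** Coning a missing facet of a vertex link gives a clique that is not a face. If the link is a
    standard sphere, the cone over its vertices is a clique of size [d.+2], which [clique_std]
    settles. *)
Lemma missing_exists d X : 2 < d -> tight d X ->
  (exists2 Z : {set V}, #|Z| = d.+2 & X = std_sphere Z) \/
  exists2 s : {set V}, #|s| = d.+1 & missing X s.
Proof.
case: d => [|[|[|d]]] // _; elim: d X => [|d IH] X tX; first exact: missing_exists3.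
have [nX _] := tX; have cX := npm_complex nX.
have [F0 F0X] := npm_facet nX; have := F0X; rewrite in_facets => /andP[F0X' /eqP cF0].
have /card_gt0P[w wF] : 0 < #|F0| by rewrite cF0.
have wX : [set w] \in X by apply: cX F0X' _; rewrite sub1set.
have inL e : (e \in link X [set w]) = (w \notin e) && (w |: e \in X) by rewrite in_vlink.
have clw Z : w \notin Z -> clique (link X [set w]) Z -> clique X (w |: Z).
  move=> wZ cl; apply: cliqueU => [x y /set1P-> /set1P->|x y xZ yZ|x y /set1P-> yZ].
  - by rewrite setUid.
  - by have := cl x y xZ yZ; rewrite inE => /andP[].
  by have := cl y y yZ yZ; rewrite setUid inL => /andP[].
have tL : tight d.+3 (link X [set w]) by apply: tight_link tX wX.
case: (IH _ tL) => [[Z cZ eL]|[s cs ms]].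
  have wZ : w \notin Z.
    apply/negP=> wZ; have : [set w] \in link X [set w].
      by rewrite eL inE properEcard sub1set wZ cards1 cZ.
    by rewrite inL set11.
  have clZ : clique X (w |: Z).
    apply: clw => // x y xZ yZ; rewrite eL inE properEcard subUset !sub1set xZ yZ cZ cards2 /=.
    by case: (_ != _).
  have cwZ : #|w |: Z| = d.+4.+2 by rewrite cardsU1 wZ cZ.
  by have [XZ|] := clique_std (isT : 1 < d.+4) tX clZ cwZ; [left; exists (w |: Z) | right].
have ws : w \notin s.
  apply/negP=> wsI; have [_ /(_ [set w])] := ms; rewrite inL set11 properEcard sub1set wsI.
  by rewrite cards1 cs => /(_ isT).
right; exists (w |: s); first by rewrite cardsU1 ws cs.
apply: (clique_missing _ tX) => //; last by case: ms; rewrite inL ws.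
  by apply: clw ws _; apply: missing_clique ms; rewrite cs.
by rewrite cardsU1 ws cs.
Qed.

End Tight.

(** * Missing facets separate *)

Section Separation.
Variable V : finType.
Implicit Types (X T E Q : {set {set V}}) (A B F G R S a e s U W Z : {set V}) (d : nat).

(* Euler's formula makes the graph induced off [s] too sparse to be connected. *)
Lemma surface_separates X s : tight 2 X -> #|s| = 3 -> missing X s ->
  exists A B, separates X s A B.
Proof.
move=> [nX eX] cs ms; have cX := npm_complex nX.
have cls : clique X s by apply: missing_clique; rewrite ?cs.
have sV : s \subset vertices X.
  by apply/subsetP=> x xs; rewrite verticesP // -[[set x]]setUid; apply: cls.
pose A := vertices X :\: s.
have es : #|esub X s| = 3 by rewrite esub_clique // cs.
have eA : #|esub X (~: A)| = 3.
  rewrite -es; apply: eq_card => e; rewrite !inE; case: (boolP (e \in X)) => //= eF; congr (_ && _).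
  apply/subsetP/subsetP => h x xe; have := h x xe; rewrite !inE ?negb_and ?negbK.
    by rewrite (subsetP (face_vertices eF) x xe) orbF.
  by move=> ->.
have cFs F : F \in facets 2 X -> #|F :&: A| + #|F :&: s| = 3 /\ #|F :&: s| != 3.
  rewrite in_facets => /andP[FX /eqP cF]; split.
    rewrite -cF -(cardsID s F) addnC; congr (_ + _); apply: eq_card => x; rewrite !inE.
    case: (boolP (x \in F)) => //= xF; rewrite ?andbF //= ?andbT.
    by rewrite (subsetP (face_vertices FX)) ?andbT.
  apply/eqP=> c; case: ms => /negP[]; suff <- : F = s by [].
  have /eqP Fs : F :&: s == F by rewrite eqEcard subsetIl c cF.
  by apply/eqP; rewrite eqEcard cs cF andbT -Fs subsetIr.
(* The three edges of [s] lie in two triangles each, and since [s] is no face, these six triangles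
   are distinct with third vertex in [A]. *)
have t1 : #|tri X A 1| = 6.
  have := surface_edges s nX; rewrite es -[2 * 3]/6 => ->.
  rewrite -sum1dep_card big_mkcondr; apply: eq_bigr => F /cFs[].
  by case: #|F :&: A| => [|[|[|[|k]]]]; case: #|F :&: s| => [|[|[|[|l]]]].
have [y ys] : exists y, y \in s by apply/card_gt0P; rewrite cs.
have [G GX yG] : exists2 G, G \in facets 2 X & y \in G.
  by apply: vertex_facet nX _ _; apply: (subsetP sV).
have GA : ~~ (G \subset A) by apply/subsetPn; exists y; rewrite // inE ys.
have eu := surface_euler A nX; have cA : #|vertices X| = #|A| + 3.
  by rewrite -cs addnC -(cardsID s (vertices X)) (setIidPr sV).
have [lA|[S [x [z [xS zS cr]]]]] := unlinked (esub X A) A.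
  (* Euler's formula now reads [#|A| + #|tri X A 3| = #|esub X A| + 2], one more than a connected
     [A] allows. *)
  have := surface_collapse nX lA GX GA; rewrite cA (_ : 'C(4, 2) = 6) // in eX.
  by rewrite eA t1 in eu; natlia.
exists (A :&: S), (A :\: S); split.
- by apply/set0Pn; exists x.
- by apply/set0Pn; exists z.
- by rewrite setID setUC -{1}(setIidPr sV) setID.
- split; rewrite -setI_eq0; apply/eqP/setP=> t; rewrite !inE;
    by case: (t \in s); case: (t \in S); rewrite ?andbF.
move=> u v uS vS; have := cr u v uS vS; apply: contra => uvX.
have uv : u != v by apply: contraTneq uS => ->; move: vS; rewrite !inE => /andP[/negPf ->]; rewrite andbF.
rewrite inE uvX cards2 uv subUset !sub1set.
by move: uS vS; rewrite ![_ \in A :&: S]inE ![_ \in A :\: S]inE => /andP[-> _] /andP[_ ->].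
Qed.

Lemma star_grow d X U G w : 1 < d -> normal_pm d.+1 X -> G \in facets d.+1 X -> w \in G ->
  G \subset U -> #|esub X U| + d.+2 * #|nb X w :\: U| <= #|esub X (U :|: nb X w)|.
Proof.
move=> d1 nX GX wG GU; have cX := npm_complex nX.
have wX : [set w] \in X.
  by move: GX; rewrite in_facets => /andP[GX _]; apply: cX GX _; rewrite sub1set.
have rL := npm_rigid d1 (npm_vlink (ltnW d1) nX wX).
have dG : [disjoint ~: U & G] by rewrite disjoint_sym disjoints_subset setCK.
have := esub_super X U (nb X w); have := star_step cX rL GX wG dG.
have -> : ~: U :&: nb X w = nb X w :\: U by rewrite setIC -setDE.
have -> : nb X w :\: ~: U = U :&: nb X w by rewrite setDE setCK setIC.
by natlia.
Qed.

Lemma missing_link X s p : is_complex X -> p \in s -> missing X s ->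
  missing (link X [set p]) (s :\ p).
Proof.
move=> cX ps [sX h]; split; first by rewrite in_vlink // setD1K // (negPf sX) andbF.
move=> B /properP[]; rewrite subsetD1 => /andP[Bs pB] [x /setD1P[xp xs] xB].
rewrite in_vlink // pB h //; apply/properP; split; first by rewrite subUset sub1set ps.
by exists x; rewrite // !inE negb_or xp.
Qed.

(** [cap_lower] for one side of the link of [p], coned at [p]. It serves twice: for the initial
    region and for the opposite side [U']. *)
Lemma half_star d X s p A B : 1 < d -> normal_pm d.+1 X -> #|s| = d.+2 -> p \in s ->
  missing X s -> separates (link X [set p]) (s :\ p) A B ->
  d.+2 * #|A :|: s| <= #|esub X (A :|: s)| + 'C(d.+3, 2).
Proof.
move=> d1 nX cs ps ms sep; have cX := npm_complex nX.
have pX : [set p] \in X.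
  by case: ms => _; apply; rewrite properEcard sub1set ps cards1 cs.
set L := link X [set p] in sep *; set t := s :\ p in sep *.
have ct : #|t| = d.+1 by have := cardsD1 p s; rewrite ps cs add1n => -[].
have mt : missing L t := missing_link cX ps ms.
have nL : normal_pm d L := npm_vlink (ltnW d1) nX pX.
have low := cap_lower d1 nL ct mt sep.
have [_ _ eV _ _] := sep.
have pV : p \notin vertices L by rewrite vertices_vlink // !inE eqxx.
have eD : (A :|: s) :\ p = A :|: t.
  rewrite setDUl; congr (_ :|: _); apply/setDidPl; rewrite disjoint_sym disjoints1.
  by apply: contra pV => pA; rewrite -eV !inE pA.
have pW : p \in A :|: s by rewrite inE ps orbT.
have := @cone_sub _ X p (A :|: s) (esub L (A :|: t)) cX pW.
have sN : A :|: s \subset nb X p.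
  apply/subsetP=> x xW; have [->|xp] := eqVneq x p; first exact: nb_self.
  have xAt : x \in A :|: t by rewrite -eD in_setD1 xp.
  have : x \in vertices L.
    by rewrite -eV; move: xAt; rewrite !in_setU => /orP[->|->]; rewrite ?orbT.
  by rewrite vertices_vlink // => /setD1P[].
move/(_ sN); rewrite eD => /(_ _)h.
have {h} : #|esub L (A :|: t)| + #|A :|: t| <= #|esub X (A :|: s)|.
  apply: h => e; rewrite inE => /and3P[eL /eqP ce eW]; split=> //.
  by move: eL; rewrite inE => /andP[].
by move: low; rewrite (cardsD1 p (A :|: s)) pW eD (binS2 d.+1) add1n mulnS mulSn; natlia.
Qed.

Section Growth.
Variables (d : nat) (X : {set {set V}}) (s U' : {set V}).
Hypotheses (d1 : 1 < d) (tX : tight d.+1 X) (cs : #|s| = d.+2) (ms : missing X s).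
Hypotheses (sU' : s \subset U') (U'V : U' \subset vertices X).
Hypothesis lowU' : d.+2 * #|U'| <= #|esub X U'| + 'C(d.+3, 2).

(** [U'] is the fixed opposite side, to be met in [s] only. The fourth clause provides the facet
    that [star_grow] needs at each vertex off [s]. *)
Definition region U := [&& s \subset U, U \subset vertices X, U :&: U' == s,
  [forall u in U :\: s, exists G in facets d.+1 X, (u \in G) && (G \subset U)] &
  d.+2 * #|U| <= #|esub X U| + 'C(d.+3, 2)].

(* The new common vertices [J] of [U + N w] and [U'] would have to span, together
   with [s], [(d+2) #|J|] new edges; with the [#|J|] edges from [w] to [J] this
   exceeds what tightness allows when adding [J] to [U]. *)
Lemma region_grow U w : region U -> w \in U :\: s -> region (U :|: nb X w).
Proof.
case/and5P=> sU UV /eqP UU' /forall_inP hU lowU wUs; have [nX _] := tX.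
have cX := npm_complex nX; have d2 : 1 < d.+1 by apply: leqW.
have /exists_inP[G GX /andP[wG GU]] := hU w wUs.
have /setDP[wU ws] := wUs.
have wX : [set w] \in X by rewrite -verticesP //; apply: (subsetP UV).
set N := nb X w; have NV : N \subset vertices X := nb_vertices X w.
have grow : #|esub X U| + d.+2 * #|N :\: U| <= #|esub X (U :|: N)| := star_grow d1 nX GX wG GU.
have cUN : #|U :|: N| = #|U| + #|N :\: U|.
  rewrite cardsU [U :&: N]setIC; have := cardsID U N; have := subset_leq_card (subsetIl N U).
  natlia.
have lowUN : d.+2 * #|U :|: N| <= #|esub X (U :|: N)| + 'C(d.+3, 2).
  by rewrite cUN mulnDr; natlia.
pose J := (N :&: U') :\: U; pose I := (U :|: N) :&: U'.
have eI : I = s :|: J.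
  rewrite -UU'; apply/setP=> x; rewrite [in LHS]/I [in RHS]/J; clearbody N; rewrite !inE.
  by case: (x \in U); case: (x \in N); case: (x \in U').
have dsJ : s :&: J = set0.
  apply/eqP; rewrite setI_eq0 disjoints_subset; apply/subsetP=> x xs.
  by rewrite in_setC in_setD (subsetP sU).
have cI : #|I| = d.+2 + #|J| by rewrite eI cardsU dsJ cards0 subn0 cs.
have es : #|esub X s| = 'C(d.+2, 2).
  by rewrite esub_clique ?cs //; apply: missing_clique ms; rewrite cs.
(* The squeeze: [U :|: N] and [U'] meet the lower bound and their union obeys the tight upper bound,
   so the intersection [I] meets the lower bound. *)
have lowI : d.+2 * #|I| <= #|esub X I| + 'C(d.+3, 2).
  have up : #|esub X (U :|: N :|: U')| + 'C(d.+3, 2) <= d.+2 * #|U :|: N :|: U'|.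
    apply: (tight_upper d2 tX GX); last by rewrite !subUset UV NV U'V.
    by rewrite -setUA (subset_trans GU) ?subsetUl.
  have := esub_super X (U :|: N) U'; rewrite -/I.
  have := congr1 (muln d.+2) (cardsUI (U :|: N) U'); rewrite -/I !mulnDr; natlia.
have J0 : J = set0.
  have upJ : #|esub X (U :|: J)| + 'C(d.+3, 2) <= d.+2 * #|U :|: J|.
    apply: (tight_upper d2 tX GX); first by rewrite (subset_trans GU) ?subsetUl.
    rewrite subUset UV; apply: subset_trans U'V.
    by apply/subsetP=> x /setDP[/setIP[]].
  have dUJ : U :&: J = set0.
    apply/eqP; rewrite setI_eq0 disjoints_subset; apply/subsetP=> x xU.
    by rewrite in_setC in_setD xU.
  have cUJ : #|U :|: J| = #|U| + #|J| by rewrite cardsU dUJ cards0 subn0.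
  have UI : U :&: I = s by rewrite eI setIUr dUJ setU0; apply/setIidPr.
  have cUI : #|esub X U :|: esub X I| + 'C(d.+2, 2) = #|esub X U| + #|esub X I|.
    by rewrite -es -{1}UI esubI cardsUI.
  have wJ : w \notin J by rewrite in_setD wU.
  have wI : w \notin I by rewrite eI in_setU (negPf ws) (negPf wJ).
  have spk : #|esub X U :|: esub X I| + #|J| <= #|esub X (U :|: J)|.
    rewrite -(card_spokes wJ); apply: card_disjoint_sub.
    - rewrite disjoint_sym disjoints_subset; apply/subsetP=> _ /imsetP[x xJ ->].
      rewrite in_setC in_setU negb_or; apply/andP; split; rewrite inE !negb_and subUset !sub1set.
        by have /setDP[_ /negPf ->] := xJ; rewrite andbF !orbT.
      by rewrite (negPf wI) !orbT.
    - rewrite subUset !esub_sub ?subsetUl // eI subUset subsetUr.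
      by rewrite (subset_trans sU) ?subsetUl.
    apply/subsetP=> _ /imsetP[x xJ ->].
    have wx : w != x by apply: contraNneq wJ => ->.
    rewrite inE cards2 wx subUset !sub1set !in_setU wU xJ orbT !andbT setUC -in_nb.
    by have /setDP[/setIP[]] := xJ.
  apply/eqP; rewrite -cards_eq0 -leqn0.
  have := bin_sq d.+1; rewrite cI mulnDr in lowI; rewrite cUJ mulnDr in upJ; natlia.
apply/and5P; split=> //.
- by rewrite (subset_trans sU) ?subsetUl.
- by rewrite subUset UV.
- by rewrite -/I eI J0 setU0.
apply/forall_inP=> u /setDP[/setUP[uU|uN] us].
  have uUs : u \in U :\: s by rewrite in_setD us.
  have /exists_inP[H HX /andP[uH HU]] := hU u uUs.
  by apply/exists_inP; exists H => //; rewrite uH (subset_trans HU) ?subsetUl.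
move: uN; rewrite in_nb => /(npm_ext nX)[H HX]; rewrite subUset !sub1set => /andP[uH wH].
apply/exists_inP; exists H => //; rewrite uH subsetU // face_nb ?orbT //.
by move: HX; rewrite in_facets => /andP[].
Qed.

End Growth.

(** A largest region contains the star of each of its vertices off [s], so no edge leads from there
    out of the region; the vertices of [B] stay outside because the region meets [B :|: s] in [s]
    alone. *)
Lemma tight_separates d X s : 1 < d -> tight d X -> #|s| = d.+1 -> missing X s ->
  exists A B, separates X s A B.
Proof.
case: d => [|[|d]] // _; elim: d X s => [|d IH] X s tX cs ms; first exact: surface_separates.
have [nX _] := tX; have cX := npm_complex nX; have [_ prs] := ms.
have [p ps] : exists p, p \in s by apply/card_gt0P; rewrite cs.
have sV : s \subset vertices X.
  apply/subsetP=> x xs; rewrite verticesP //; apply: prs.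
  by rewrite properEcard sub1set xs cards1 cs.
have pX : [set p] \in X by rewrite -verticesP //; apply: (subsetP sV).
pose L := link X [set p]; pose t := s :\ p.
have tL : tight d.+2 L by apply: tight_link tX pX.
have [nL _] := tL; have cL := npm_complex nL.
have ct : #|t| = d.+3 by have := cardsD1 p s; rewrite ps cs add1n => -[].
have mt : missing L t := missing_link cX ps ms.
have [A [B sep]] := IH L t tL ct mt.
have [/set0Pn[a0 aA] /set0Pn[b0 bB] eV [At Bt dAB] _] := sep.
have LV : vertices L \subset vertices X.
  by rewrite vertices_vlink //; apply: subset_trans (subsetDl _ _) (nb_vertices _ _).
have pV : p \notin vertices L by rewrite vertices_vlink // !inE eqxx.
have AV : A \subset vertices L by rewrite -eV -setUA subsetUl.
have BV : B \subset vertices L by rewrite -eV setUAC subsetUr.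
have outs (C : {set V}) : C \subset vertices L -> [disjoint C & t] -> [disjoint C & s].
  move=> CV Ct; rewrite disjoints_subset; apply/subsetP=> x xC; rewrite in_setC.
  apply/negP=> xs; have := disjointFr Ct xC; rewrite in_setD1 xs andbT => /negbFE/eqP xp.
  by move: pV; rewrite -xp (subsetP CV).
have As := outs A AV At; have Bs := outs B BV Bt.
have lowA := half_star (isT : 1 < d.+2) nX cs ps ms sep.
have lowB := half_star (isT : 1 < d.+2) nX cs ps ms (separates_sym sep).
have rA : region d.+2 X s (B :|: s) (A :|: s).
  apply/and5P; split=> //; first exact: subsetUr.
  - by rewrite subUset sV (subset_trans AV).
  - by rewrite -setUIl; move: dAB; rewrite -setI_eq0 => /eqP ->; rewrite set0U.
  apply/forall_inP=> u /setDP[/setUP[uA _|->//]].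
  have [F FL uF] := vertex_facet nL (subsetP AV u uA).
  have := FL; rewrite in_facets in_vlink // => /andP[/andP[pF pFX] /eqP cF].
  have FL' : F \in L by move: FL; rewrite in_facets => /andP[].
  have FA := face_side nL sep FL' (facet_meets uF uA).
  apply/exists_inP; exists (p |: F); first by rewrite in_facets pFX cardsU1 pF cF add1n eqxx.
  rewrite in_setU uF orbT subUset sub1set in_setU ps orbT /=.
  by apply: subset_trans FA _; rewrite setUS // subsetDl.
case: (@arg_maxnP _ (A :|: s) (region d.+2 X s (B :|: s)) (fun U => #|U|) rA) => U rU mU.
have sU' : s \subset B :|: s by apply: subsetUr.
have U'V : B :|: s \subset vertices X by rewrite subUset sV (subset_trans BV).
have step w : w \in U :\: s -> nb X w \subset U.
  move=> wU; have /mU c := region_grow (isT : 1 < d.+2) tX cs ms U'V lowB rU wU.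
  apply/setUidPl/esym/eqP; rewrite eqEcard subsetUl; exact: c.
have cU : #|A :|: s| <= #|U| by apply: mU.
have /and5P[sU UV /eqP UU' _ _] := rU.
exists (U :\: s), (vertices X :\: U); split.
- rewrite -card_gt0 cardsDS // subn_gt0; apply: leq_trans cU.
  apply: proper_card; rewrite properE subsetUr; apply/subsetPn; exists a0.
    by rewrite in_setU aA.
  by rewrite (disjointFr As aA).
- apply/set0Pn; exists b0; rewrite in_setD (subsetP LV) ?(subsetP BV) // andbT.
  apply/negP=> bU; have := disjointFr Bs bB.
  by rewrite -UU' in_setI bU in_setU bB.
- by rewrite setUAC [U :\: s :|: s]setUC -{1}(setIidPr sU) setID -{1}(setIidPr UV) setID.
- split; rewrite disjoints_subset; apply/subsetP=> x; rewrite !inE.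
  + by case/andP.
  + by case/andP=> xU _; apply: contra xU; apply: (subsetP sU).
  by case/andP=> _ ->.
move=> u v uU; rewrite inE => /andP[vU _]; apply: contra vU => uv.
by apply: (subsetP (step u uU)); rewrite inE setUC.
Qed.

End Separation.

(** * Stacked spheres *)

Section Stacked.
Variable V : finType.
Implicit Types (X T E Q : {set {set V}}) (A B F G N R S a e s U W Z : {set V}) (d : nat).

Lemma cap_card d X s A B : 1 < d -> normal_pm d X -> #|s| = d.+1 -> missing X s ->
  separates X s A B -> #|vertices (cap X s A)| < #|vertices X|.
Proof.
move=> d1 nX cs ms sep; rewrite (vertices_cap d1 nX cs ms sep).
have [_ /set0Pn[b bB] eV [_ Bs dAB] _] := sep.
rewrite -eV; apply: proper_card; rewrite properE; apply/andP; split.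
  by rewrite -setUA setUCA subsetUr.
apply/subsetPn; exists b; first by rewrite !inE bB orbT.
by rewrite inE (disjointFl dAB bB) (disjointFr Bs bB).
Qed.

(** Prescribing a facet to avoid makes the induction work: in the cap on the side away from [F] the
    facet to avoid is [s], so the vertex found is off [s] and has the same neighbours in [X]. The
    count [d.+2] includes [x] itself. *)
Lemma simplicial_vertex d X F : 2 < d -> tight d X -> F \in facets d X ->
  exists x, [/\ x \in vertices X, x \notin F & #|nb X x| = d.+2].
Proof.
move=> d2; have d1 := ltnW d2.
elim: {X}_.+1 {-2}X (ltnSn #|vertices X|) F => // n IH X; rewrite ltnS => Xn F tX FX.
have [nX _] := tX; have cX := npm_complex nX.
have := FX; rewrite in_facets => /andP[FX' /eqP cF].
case: (missing_exists d2 tX) => [[Z cZ eX]|[s cs ms]].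
  have FZ : F \proper Z by move: FX'; rewrite eX inE.
  have [_ [x xZ xF]] := properP FZ; exists x.
  have nbx v : (v \in nb X x) = (v \in Z).
    have c2 : (v != x).+1 < d.+2 by case: (v != x); move: d2; natlia.
    by rewrite inE eX inE properEcard subUset !sub1set xZ andbT cards2 cZ c2 andbT.
  split=> //; first by apply: (subsetP (nb_vertices X x)); rewrite nbx.
  by rewrite -cZ; apply: eq_card.
have aux A B : separates X s A B -> F \subset A :|: s ->
    exists x, [/\ x \in vertices X, x \notin F & #|nb X x| = d.+2].
  move=> sep FA; have sep' := separates_sym sep.
  have sF : s \in facets d (cap X s B) by rewrite in_facets in_cap eqxx cs /=.
  have tB := tight_cap d1 tX cs ms sep'.
  have Bn := leq_trans (cap_card d1 nX cs ms sep') Xn.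
  have [x [xV xs cx]] := IH _ Bn s tB sF.
  move: xV; rewrite (vertices_cap d1 nX cs ms sep') inE (negPf xs) orbF => xB.
  have [_ _ eV [_ _ dAB] _] := sep; exists x; split.
  - by rewrite -eV !inE xB orbT.
  - by apply: contra xs => /(subsetP FA); rewrite inE (disjointFl dAB xB).
  rewrite -cx; apply: eq_card => v; rewrite [LHS]inE [RHS]inE in_cap.
  have -> : ([set v; x] == s) = false by apply: contraNF xs => /eqP <-; rewrite !inE eqxx orbT.
  case: (boolP ([set v; x] \in X)) => //= vxX; apply/esym/(face_side nX sep' vxX).
  by apply: (@facet_meets _ _ _ x); rewrite // !inE eqxx orbT.
have [A [B sep]] := tight_separates d1 tX cs ms.
have [dFA|mF] := boolP [disjoint F & A]; last exact: aux sep (face_side nX sep FX' mF).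
apply: aux (separates_sym sep) _; have [_ _ eV _ _] := sep.
apply/subsetP=> x xF; have := subsetP (face_vertices FX') x xF.
by rewrite -eV !inE (disjointFr dFA xF).
Qed.

(* The two facets through a ridge are the only [d+1]-sets between the ridge and [N]. *)
Lemma ridge_fill d X N R : normal_pm d X -> #|N| = d.+2 -> R \in X -> #|R| = d ->
  (forall F, F \in facets d X -> R \subset F -> F \subset N) ->
  forall F, R \subset F -> F \subset N -> #|F| = d.+1 -> F \in X.
Proof.
move=> nX cN RX cR hN F RF FN cF; have := npm_ridge nX RX cR.
have := card_between (subset_trans RF FN); rewrite cN cR -addn2 addKn => c2 c1.
have sub : [set F in facets d X | R \subset F] \subset
    [set K : {set V} | [&& R \subset K, K \subset N & #|K| == d.+1]].
  apply/subsetP=> K; rewrite inE => /andP[KX RK]; rewrite inE RK (hN K) //=.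
  by move: KX; rewrite in_facets => /andP[].
have /eqP eq : [set F in facets d X | R \subset F] ==
    [set K : {set V} | [&& R \subset K, K \subset N & #|K| == d.+1]].
  by rewrite eqEcard sub c1 c2.
have : F \in [set F in facets d X | R \subset F] by rewrite eq inE RF FN cF /=.
by rewrite inE in_facets => /andP[/andP[]].
Qed.

Lemma tight_stacked d X : 2 < d -> tight d X -> stacked d X.
Proof.
move=> d2; have d1 := ltnW d2.
elim: {X}_.+1 {-2}X (ltnSn #|vertices X|) => // n IH X; rewrite ltnS => Xn tX.
have [nX _] := tX; have cX := npm_complex nX.
have [F FX] := npm_facet nX; have [x [xV _ cN]] := simplicial_vertex d2 tX FX.
have xX : [set x] \in X by rewrite -verticesP.
set N := nb X x in cN; have xN : x \in N := nb_self xX.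
have clN : clique X N.
  have full : esub X N = [set e : {set V} | e \subset N & #|e| == 2].
    apply/eqP; rewrite eqEcard cards_draws; apply/andP; split.
      by apply/subsetP=> e; rewrite !inE => /and3P[_ -> ->].
    have nX' : normal_pm d.-1.+1 X by rewrite prednK // ltnW.
    (* On [d.+2] vertices the lower bound for a star is ['C(d.+2, 2)] edges, so the star is
       complete. *)
    have := star_lower (_ : 1 < d.-1) nX' xX; rewrite -/N cN prednK ?(ltnW d1) //.
    by move=> /(_ _); have := bin_sq d; rewrite (binS2 d); natlia.
  move=> y z yN zN; have [<-|yz] := eqVneq y z.
    by rewrite setUid; move: yN; rewrite inE => h; apply: cX h _; rewrite sub1set !inE eqxx.
  have : [set y; z] \in esub X N by rewrite full inE subUset !sub1set yN zN cards2 yz.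
  by rewrite inE => /andP[].
have small B : B \subset N -> #|B| <= d -> B \in X.
  by move=> BN; apply: (clique_small d1 tX) => y z yB zB; apply: clN; apply: (subsetP BN).
(* A ridge of [B] through [x] has all its facets inside [N], so [ridge_fill] applies to it. *)
have fill B : B \subset N -> #|B| = d.+1 -> x \in B -> B \in X.
  move=> BN cB xB; have [y yB] : exists y, y \in B :\ x.
    by apply/card_gt0P; have := cardsD1 x B; rewrite xB cB add1n => -[<-]; apply: ltnW.
  have [yx yB'] := setD1P yB; have cR : #|B :\ y| = d.
    by have := cardsD1 y B; rewrite yB' cB add1n => -[].
  have RB : B :\ y \subset B by apply: subsetDl.
  apply: (ridge_fill nX cN _ cR _ RB BN cB).
    by apply: small; rewrite ?cR // (subset_trans RB).
  move=> G; rewrite in_facets => /andP[GX _] /subsetP/(_ x); rewrite !inE eq_sym yx xB.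
  by move=> /(_ isT) xG; apply: face_nb.
pose s := N :\ x; have cs : #|s| = d.+1.
  by have := cardsD1 x N; rewrite xN cN add1n => -[].
have sN : s \subset N by apply: subsetDl.
have xs : x \notin s by rewrite !inE eqxx.
have [sX|sX] := boolP (s \in X).
  rewrite (std_sphere_crit nX cN) => [|B BN cB]; first exact: stacked_base.
  have [xB|xB] := boolP (x \in B); first exact: fill.
  suff -> : B = s by [].
  by apply/eqP; rewrite eqEcard subsetD1 BN xB cB cs /=.
have ms : missing X s.
  by apply: (clique_missing d1 tX) => // y z ys zs; apply: clN; apply: (subsetP sN).
have NV : N \subset vertices X := nb_vertices X x.
have sep : separates X s (vertices X :\: N) [set x].
  split.
  (* If [N] were the whole vertex set, [ridge_fill] at any ridge of [s] would make [s] a face. *)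
  - apply/negP=> /eqP/eqP; rewrite setD_eq0 => VN; case/negP: sX.
    have [R Rs cR] : exists2 R : {set V}, R \subset s & #|R| = d.
      have /card_gt0P[b bs] : 0 < #|s| by rewrite cs.
      exists (s :\ b); first exact: subsetDl.
      by have := cardsD1 b s; rewrite bs cs add1n => -[].
    apply: (ridge_fill nX cN _ cR _ Rs sN cs).
      by apply: small; rewrite ?cR // (subset_trans Rs).
    move=> G; rewrite in_facets => /andP[GX _] _.
    exact: subset_trans (face_vertices GX) VN.
  - by apply/set0Pn; exists x; rewrite set11.
  - by rewrite -setUA setD1K // setUC -{1}(setIidPr NV) setID.
  - split; last by rewrite disjoint_sym disjoints1 in_setD xN.
      rewrite disjoints_subset; apply/subsetP=> y /setDP[_ yN].
      by rewrite in_setC; apply: contra yN; apply: (subsetP sN).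
    by rewrite disjoints1.
  by move=> u v /setDP[_ uN] /set1P->; move: uN; rewrite in_nb.
have tC := tight_cap d1 tX cs ms sep.
have Cn := leq_trans (cap_card d1 nX cs ms sep) Xn.
have vC := vertices_cap d1 nX cs ms sep.
have -> : X = starring (cap X s (vertices X :\: N)) s x.
  apply/setP=> B; rewrite inE; apply/idP/orP => [BX|[]].
  - have [xB|xB] := boolP (x \in B); last first.
      left; rewrite inE in_cap BX; have [Bs|_] /= := eqVneq B s; first by rewrite Bs (negPf sX) in BX.
      rewrite andbT; apply/subsetP=> y yB; rewrite in_setU in_setD in_setD1.
      rewrite (subsetP (face_vertices BX)) // andbT.
      have -> : y != x by apply: contraNneq xB => <-.
      by rewrite orNb.
    right; apply/imsetP; exists (B :\ x); last by rewrite setD1K.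
    rewrite inE properEcard cs setSD ?face_nb //=.
    by have := cardsD1 x B; rewrite xB add1n => <-; apply: npm_dim BX.
  - rewrite inE in_cap; case: eqP => [//|_] /=; by rewrite andbT => /andP[].
  case/imsetP=> C; rewrite inE => /properP[Cs [b bs bC]] ->.
  have [bx bN] := setD1P bs.
  apply: cX (fill (N :\ b) (subsetDl _ _) _ _) _.
  - by have := cardsD1 b N; rewrite bN cN add1n => -[].
  - by rewrite in_setD1 eq_sym bx.
  rewrite subUset sub1set in_setD1 eq_sym bx xN subsetD1 bC andbT /=.
  by rewrite (subset_trans Cs sN).
apply: stacked_star => //; first exact: IH.
  by rewrite in_cap eqxx.
by rewrite vC in_setU in_setD xN (negPf xs).
Qed.

Lemma std_sphere_tight d Z : 1 < d -> #|Z| = d.+2 -> tight d (std_sphere Z).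
Proof.
move=> d1 cZ; set X := std_sphere Z.
have inX A : (A \in X) = (A \subset Z) && (#|A| <= d.+1).
  by rewrite inE properEcard cZ.
have cX : is_complex X.
  move=> A B; rewrite !inX => /andP[AZ cA] BA.
  by rewrite (subset_trans BA AZ) (leq_trans (subset_leq_card BA) cA).
have inF F : (F \in facets d X) = (F \subset Z) && (#|F| == d.+1).
  by rewrite in_facets inX -andbA; case: eqP => [->|]; rewrite ?leqnn ?andbT ?andbF.
have vX : vertices X = Z.
  by apply/setP=> v; rewrite verticesP // inX sub1set cards1 andbT.
have eX : #|edges X| = 'C(d.+2, 2).
  rewrite -cZ -cards_draws; apply: eq_card => e; rewrite inE [RHS]inE inX.
  by case: eqP => [->|]; rewrite ?andbF // ltnS (ltnW d1) !andbT.
split; last first.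
  by rewrite vX cZ eX {1}(binS2 d) mulnS; have := bin_sq d; natlia.
apply: npmI => //; first exact: ltnW.
- by rewrite inX sub0set cards0.
- move=> A; rewrite inX => /andP[AZ cA].
  have /properP[_ [z zZ zA]] : A \proper Z by rewrite properEcard AZ cZ.
  exists (Z :\ z); last by rewrite subsetD1 AZ.
  by rewrite inF subsetDl; have := cardsD1 z Z; rewrite zZ cZ add1n => -[->] /=.
- move=> R; rewrite inX => /andP[RZ _] cR.
  have := card_between RZ; rewrite cZ cR -addn2 addKn => <-; apply: eq_card => F.
  by rewrite [LHS]inE [RHS]inE inF andbC.
move=> a; rewrite inX => /andP[aZ _] ca S u v ua va uX vX' uS cl.
apply: (cl u v) => //; move: uX vX'; rewrite !inX !subUset !sub1set aZ.
move=> /andP[/andP[-> _] _] /andP[/andP[-> _] _] /=.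
by apply: leq_trans (leq_card_setU _ _) _; rewrite cards2; case: (u != v); natlia.
Qed.

(** * Starring a facet of a normal pseudomanifold *)

Section Starring.
Variables (d : nat) (X : {set {set V}}) (s : {set V}) (x : V).
Hypotheses (d1 : 1 < d) (nX : normal_pm d X) (sX : s \in X) (cs : #|s| = d.+1).
Hypothesis xV : x \notin vertices X.
Let cX := npm_complex nX.
Let Y := starring X s x.

Lemma fresh A : A \in X -> x \notin A.
Proof. by move=> AX; apply: contra xV => xA; apply: (subsetP (face_vertices AX)). Qed.

Lemma in_starring A : (A \in Y) =
  if x \in A then A :\ x \proper s else (A \in X) && (A != s).
Proof.
rewrite inE; have [xA|xA] := boolP (x \in A).
  apply/orP/idP => [[]|As].
  - by rewrite inE => /andP[/fresh]; rewrite xA.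
  - case/imsetP=> B; rewrite inE => Bs eA; rewrite eA setU1K //.
    by apply: contra (fresh sX); apply: (subsetP (proper_sub Bs)).
  by right; apply/imsetP; exists (A :\ x); rewrite ?inE // setD1K.
rewrite inE; apply/orP/idP => [[//|/imsetP[B _ eA]]|]; last by left.
by rewrite eA setU11 in xA.
Qed.

Lemma starring_complex : is_complex Y.
Proof.
move=> A B; rewrite !in_starring => AY BA; have [xB|xB] := boolP (x \in B).
  by rewrite (subsetP BA) // in AY; apply: sub_proper_trans AY; apply: setSD.
have BAx : B \subset A :\ x by rewrite subsetD1 BA.
case: (boolP (x \in A)) AY => [xA As|xA /andP[AX nA]].
  have Bs := sub_proper_trans BAx As.
  by rewrite (cX sX (proper_sub Bs)); move: Bs; rewrite properEneq => /andP[].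
rewrite (cX AX BA); apply: contraNneq nA => Bs.
by rewrite eq_sym eqEcard -{1}Bs BA cs (npm_dim nX AX).
Qed.

Lemma facet_old F : F \in X -> F != s -> #|F| = d.+1 -> F \in facets d Y.
Proof. by move=> FX Fs cF; rewrite in_facets in_starring (negPf (fresh FX)) FX Fs cF /=. Qed.

Lemma proper_s_face B : B \proper s -> B \in Y.
Proof.
move=> Bs; have BX := cX sX (proper_sub Bs); rewrite in_starring (negPf (fresh BX)) BX.
by move: Bs; rewrite properEneq => /andP[].
Qed.

(** At a ridge inside [s] the facet [x |: R] takes the place of [s]; a ridge through [x] has the two
    sets between it and [x |: s]. In the link of a face through [x] any two vertices are
    adjacent. *)
Lemma starring_npm : normal_pm d Y.
Proof.
have xs := fresh sX.
have cone B : B \proper s -> x |: B \in Y.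
  move=> Bs; rewrite in_starring setU11 setU1K //.
  by apply: contra xs; apply: (subsetP (proper_sub Bs)).
have csD y : y \in s -> #|s :\ y| = d.
  by move=> ys; have := cardsD1 y s; rewrite ys cs add1n => -[].
have newF y : y \in s -> x |: s :\ y \in facets d Y.
  move=> ys; rewrite in_facets cone ?properD1 //= cardsU1 csD // in_setD1 (negPf xs) andbF.
  by rewrite add1n.
apply: npmI; first exact: ltnW; first exact: starring_complex.
- apply: proper_s_face; rewrite proper0 -card_gt0 cs //.
- have extp B : B \proper s -> exists2 F, F \in facets d Y & x |: B \subset F.
    move=> /properP[Bs [y ys yB]]; exists (x |: s :\ y); first exact: newF.
    by rewrite setUS // subsetD1 Bs.
  move=> A; rewrite in_starring; case: (boolP (x \in A)) => [xA|xA /andP[AX nA]].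
    by case/extp=> F FY AF; exists F; rewrite // -(setD1K xA).
  have [F FX AF] := npm_ext nX AX; have := FX; rewrite in_facets => /andP[FX' /eqP cF].
  have [Fs|Fs] := eqVneq F s; last by exists F => //; apply: facet_old.
  have /extp[G GY AG] : A \proper s by rewrite properEneq nA -Fs.
  by exists G => //; apply: subset_trans AG; apply: subsetUr.
- move=> R RY cR; have := RY; rewrite in_starring.
  case: (boolP (x \in R)) => [xR Rs|xR /andP[RX nR]].
    have cR' : #|R :\ x|.+1 = d by have := cardsD1 x R; rewrite xR cR add1n.
    have RxS : R \subset x |: s by rewrite -(setD1K xR) setUS // proper_sub.
    have c2 : #|x |: s| = d.+2 by rewrite cardsU1 xs cs.
    have := card_between RxS; rewrite c2 cR -addn2 addKn => <-; apply: eq_card => F.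
    rewrite [LHS]inE [RHS]inE in_facets in_starring; case: (boolP (R \subset F)) => RF; rewrite ?andbF //=.
    have xF := subsetP RF x xR; rewrite xF andbT; case: eqP => cF; rewrite ?andbF //= !andbT.
    have cFx : #|F :\ x| = d by have := cardsD1 x F; rewrite xF cF add1n => -[].
    by rewrite properEcard cFx cs ltnSn andbT subDset.
  rewrite -(npm_ridge nX RX cR); have [Rs|Rs] := boolP (R \subset s); last first.
    apply: eq_card => F; rewrite [LHS]inE [RHS]inE !in_facets in_starring.
    case: (boolP (R \subset F)) => RF; rewrite ?andbF //= !andbT; congr (_ && _).
    have [xF|xF] := boolP (x \in F).
      apply/idP/idP => [Fs|/fresh]; last by rewrite xF.
      by case/negP: Rs; apply: subset_trans (proper_sub Fs); rewrite subsetD1 RF.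
    by rewrite andb_idr // => _; apply: contraNneq Rs => <-.
  have sR : s \in [set F in facets d X | R \subset F] by rewrite inE in_facets sX cs Rs eqxx.
  have -> : [set F in facets d Y | R \subset F] =
            (x |: R) |: ([set F in facets d X | R \subset F] :\ s).
    apply/setP=> F; rewrite [LHS]inE in_setU1 in_setD1 [in RHS]inE !in_facets in_starring.
    have [xF|xF] := boolP (x \in F).
      have -> : (F \in X) = false by apply/negP=> /fresh; rewrite xF.
      rewrite /= andbF orbF; apply/idP/eqP => [/andP[/andP[Fs /eqP cF] RF]|eF].
        by apply/esym/eqP; rewrite eqEcard subUset sub1set xF RF cF cardsU1 xR cR /=.
      by rewrite eF setU1K // cardsU1 xR cR subsetUr properEcard Rs cs cR ltnSn add1n eqxx.
    have -> : (F == x |: R) = false by apply: contraNF xF => /eqP->; rewrite setU11.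
    by rewrite /=; case: (F \in X); case: (F == s).
  rewrite cardsU1; have -> : x |: R \notin [set F in facets d X | R \subset F] :\ s.
    by rewrite in_setD1 inE in_facets; apply/negP=> /and3P[_ /andP[/fresh]]; rewrite setU11.
  by have := cardsD1 s [set F in facets d X | R \subset F]; rewrite sR.
move=> a aY ca S u v ua va uY vY uS cl.
have := aY; rewrite in_starring; case: (boolP (x \in a)) => [xa as_|xa /andP[aX na]].
  apply: (cl u v) => //; rewrite in_starring in_setU xa /=.
  have xu : x != u by apply: contraNneq ua => <-.
  have xv : x != v by apply: contraNneq va => <-.
  move: uY vY; rewrite !in_starring !in_setU1 xa !orbT.
  move=> /proper_sub us /proper_sub vs.
  have sub : (a :|: [set u; v]) :\ x \subset s.
    apply/subsetP=> y /setD1P[yx /setUP[ya|/set2P[->|->]]].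
    - by apply: (subsetP (proper_sub as_)); rewrite in_setD1 yx.
    - by apply: (subsetP us); rewrite in_setD1 eq_sym xu setU11.
    by apply: (subsetP vs); rewrite in_setD1 eq_sym xv setU11.
  rewrite properEcard sub cs ltnS.
  have := cardsD1 x (a :|: [set u; v]); rewrite in_setU xa /=.
  have := leq_card_setU a [set u; v]; rewrite cards2 => /leqifP.
  have : #|a :|: [set u; v]| <= #|a| + #|[set u; v]| by case: (leq_card_setU a [set u; v]).
  by rewrite cards2; case: (u != v); natlia.
have nsv y : y \in s -> y \notin a -> a \subset s -> a :|: [set x; y] \in Y.
  move=> ys ya as_; rewrite in_starring !inE eqxx orbT.
  have -> : (a :|: [set x; y]) :\ x = y |: a.
    apply/setP=> z; rewrite !inE; have [->|zx] /= := eqVneq z x.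
      by rewrite (negPf xa) orbF; apply/esym/negbTE; apply: contraNneq xs => ->.
    by rewrite orbC.
  rewrite properEcard subUset sub1set ys as_ cardsU1 ya cs.
  by natlia.
have [as_|as_] := boolP (a \subset s); last first.
  have inY B : a \subset B -> (B \in Y) = (B \in X).
    move=> aB; rewrite in_starring; have [xB|xB] := boolP (x \in B).
      apply/idP/idP => [Bs|/fresh]; last by rewrite xB.
      by case/negP: as_; apply: subset_trans (proper_sub Bs); rewrite subsetD1 aB.
    by rewrite andb_idr // => _; apply: contraNneq as_ => <-.
  rewrite !inY ?subsetUr // in uY vY.
  apply: (npm_conn nX aX ca ua va uY vY uS) => y z yS ya za yzX.
  by apply: (cl y z); rewrite ?inY // subsetUl.
(* The only link edge that starring destroys is one completing [a] to [s]; a detour through [x]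
   replaces it. *)
have cone_step y z : y \in S -> a :|: [set y; z] = s -> y \notin a -> z \notin a -> z \in S.
  move=> yS es ya za; have [ys zs] : y \in s /\ z \in s.
    by rewrite -es !inE !eqxx !orbT.
  have xS : x \in S.
    by apply: (cl y x) => //; rewrite [[set y; x]]setUC nsv.
  by apply: (cl x z) => //; apply: nsv.
have clX y z : y \in S -> y \notin a -> z \notin a -> a :|: [set y; z] \in X -> z \in S.
  move=> yS ya za yzX; have [es|nes] := eqVneq (a :|: [set y; z]) s.
    exact: cone_step yS es ya za.
  by apply: (cl y z) => //; rewrite in_starring (negPf (fresh yzX)) yzX.
have [p ps pa] : exists2 p, p \in s & p \notin a.
  by apply/subsetPn/negP => /subset_leq_card; rewrite cs; natlia.
have pX : p |: a \in X by apply: cX sX _; rewrite subUset sub1set ps.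
have inXv w : w != x -> w |: a \in Y -> w |: a \in X.
  by move=> wx; rewrite in_starring in_setU1 eq_sym (negPf wx) (negPf xa) /= => /andP[].
have conn w z := npm_conn nX aX ca (S := S) (u := w) (v := z).
have [ux|ux] := eqVneq u x; have [vx|vx] := eqVneq v x; first by rewrite vx -ux.
- apply: (conn p v) => //; first exact: inXv.
  by apply: (cl u p) => //; rewrite ux; apply: nsv.
- have pS : p \in S by apply: (conn u p) => //; apply: inXv.
  by rewrite vx; apply: (cl p x) => //; rewrite [[set p; x]]setUC; apply: nsv.
by apply: (conn u v) => //; apply: inXv.
Qed.

End Starring.

End Stacked.

(** * Stacked spheres are tight; the theorem *)

Section Main.
Variable V : finType.
Implicit Types (X T E Q : {set {set V}}) (A B F G N R S a e s U W Z : {set V}) (d : nat).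

(** One new vertex and [d.+1] new edges; no edge is lost, since for [1 < d] the removed [s] is not
    an edge. *)
Lemma starring_tight d X s x : 1 < d -> tight d X -> s \in X -> #|s| = d.+1 ->
  x \notin vertices X -> tight d (starring X s x).
Proof.
move=> d1 [nX eX] sX cs xV; have nY := starring_npm d1 nX sX cs xV.
have cX := npm_complex nX; have xs := fresh xV sX; split=> //.
have cY := npm_complex nY.
have s0 : 1 < #|s| by rewrite cs ltnS ltnW.
have vY : vertices (starring X s x) = x |: vertices X.
  apply/setP=> v; rewrite in_setU1 !verticesP // in_starring // inE eq_sym.
  have [->|vx] /= := eqVneq v x.
    by rewrite setDv proper0 -card_gt0 (ltnW s0).
  by rewrite andb_idr // => _; apply: contraTneq s0 => <-; rewrite cards1.
have eY : edges (starring X s x) = edges X :|: [set [set x; y] | y in s].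
  apply/setP=> e; rewrite inE in_setU [_ \in edges X]inE in_starring //.
  have [xe|xe] := boolP (x \in e); last first.
    have -> : (e \in [set [set x; y] | y in s]) = false.
      by apply/negbTE/negP=> /imsetP[y _ eE]; rewrite eE !inE eqxx in xe.
    rewrite orbF -andbA; congr (_ && _); rewrite andb_idl // => /eqP ce.
    by apply: contraTneq d1 => es; rewrite -ltnS -cs -es ce.
  have -> : (e \in X) = false by apply/negbTE/negP=> /(fresh xV); rewrite xe.
  rewrite /=; apply/andP/imsetP => [[es ce]|[y ys ->]].
    have /cards1P[y ey] : #|e :\ x| == 1 by rewrite (cardsD1 x) xe in ce.
    exists y; last by rewrite -ey setD1K.
    by apply: (subsetP (proper_sub es)); rewrite ey set11.
  have xy : x != y by apply: contraNneq xs => ->.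
  by rewrite setU1K ?inE // cards2 xy properEcard sub1set ys cards1.
have dsp : [disjoint edges X & [set [set x; y] | y in s]].
  rewrite disjoint_sym disjoints_subset; apply/subsetP=> _ /imsetP[y _ ->].
  by rewrite in_setC inE; apply/negP=> /andP[/(fresh xV)]; rewrite !inE eqxx.
have kY : #|edges (starring X s x)| = #|edges X| + d.+1.
  rewrite eY -cs -(card_spokes xs); apply/eqP.
  by have := leq_card_setU (edges X) [set [set x; y] | y in s]; rewrite dsp => /leqifP.
by rewrite kY vY cardsU1 xV add1n mulnS; natlia.
Qed.

Lemma stacked_tight d X : 1 < d -> stacked d X -> tight d X.
Proof.
move=> d1; elim=> {X} [Z cZ|X s x _ tX sX cs xV]; first exact: std_sphere_tight.
exact: starring_tight.
Qed.

End Main.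

Theorem theorem7p8 (V : finType) :
  (forall (d : nat) (X : {set {set V}}),
      2 <= d -> normal_pm d X -> rigid d.+1 d X) /\
  (forall (d : nat) (X : {set {set V}}),
      3 <= d -> (stacked d X <-> (normal_pm d X /\ min_rigid d.+1 d X))).
Proof.
split=> d X hd; first exact: npm_rigid.
rewrite -tight_min_rigid; last exact: ltnW.
by split; [apply: stacked_tight; apply: ltnW | apply: tight_stacked].
Qed.
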